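(* There is a sequence of real numbers $(r_k)$, with $r_k\to0$ as $k\to\infty$, such that the following is true for every $k$, every graph $\mathcal{G}=(\mathcal{V},\mathcal{E})$ and every finite nonempty class $\mathcal{C}$ of open self-avoiding paths of $\mathcal{G}$ that all have length $k$ (i.e. $k$ nodes). Let $t=t(k)>0$ be the largest $t$ such that \[ h(2p_t)\;\ge\;\max\Big\{\frac8k\log(|\mathcal{C}|),\,1\Big\}. \] If $\psi\in(-1,1)$ satisfies $\psi\ge 1-\big(t/\mathsf{N}^{-1}(4/5)\big)^2$, then the test $f_t$ satisfies $R_{\mathcal{C},\psi}(f_t)\le r_k$.
   Context: An open self-avoiding path in a graph $\mathcal{G}=(\mathcal{V},\mathcal{E})$, $\mathcal{E}\subset\mathcal{V}\times\mathcal{V}$, is a finite sequence of nodes $S=(s_1,\dots,s_k)\in\mathcal{V}^k$ with $(s_j,s_{j+1})\in\mathcal{E}$ for all $j$ and $s_j\neq s_{j'}$ for $j\neq j'$. A path is also identified with its set of nodes. One observes $X=(X_i)_{i\in\mathcal{V}}$ with standard normal components. Under $\mathbb{P}_0$ (the null hypothesis) the components of $X$ are independent. For $S=(s_1,\dots,s_k)\in\mathcal{C}$ and $\psi\in(-1,1)$, under $\mathbb{P}_{S,\psi}$ the vector $(X_i)_{i\in S}$ is a stationary autoregressive process of order 1 with coefficient $\psi$, i.e. it is a centered Gaussian vector with $\mathrm{Cov}(X_{s_i},X_{s_j})=\psi^{|i-j|}$; the components $(X_i)_{i\notin S}$ are i.i.d. standard normal; and $(X_i)_{i\in S}$ and $(X_i)_{i\notin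 S}$ are independent. A test is a measurable function $f:\mathbb{R}^{\mathcal{V}}\to\{0,1\}$, and its worst-case risk is \[ R_{\mathcal{C},\psi}(f)=\mathbb{P}_0\{f(X)=1\}+\max_{S\in\mathcal{C}}\mathbb{P}_{S,\psi}\{f(X)=0\}. \] $\mathsf{N}$ denotes the standard normal distribution function, $p_t=2\mathsf{N}(t)-1$ for $t\ge0$, and $h(x)=x-\log(x)-1$ for $x>0$. For $t>0$ and $S=(s_1,\dots,s_k)\in\mathcal{C}$, define \[ V_{t,S}=\sum_{j=1}^{k-1}\mathbb{I}\{|X_{s_{j+1}}-X_{s_j}|\le\sqrt2\,t\},\qquad V_t^*=\max_{S\in\mathcal{C}}V_{t,S},\qquad f_t=\mathbb{I}\{V_t^*>k/2\}, \] where $\mathbb{I}\{\cdot\}$ is the indicator function. *)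

(* Defs.v *)
From HB Require Import structures.
From mathcomp Require Import all_boot all_order all_algebra finmap.
From mathcomp Require Import all_classical all_reals all_analysis.
From mathcomp Require Import measurable_realfun.

Set Implicit Arguments.
Unset Strict Implicit.
Unset Printing Implicit Defensive.

Import Order.TTheory GRing.Theory Num.Theory.
Import numFieldTopology.Exports numFieldNormedType.Exports.

Local Open Scope classical_set_scope.
Local Open Scope ring_scope.

(* An edge set E is an arbitrary set of ordered pairs; a path on k nodes is a
   k-tuple, its j-th node s_(j+1) being tnth S j. *)
Definition open_path (V : choiceType) (E : set (V * V)) (k : nat)
    (S : k.-tuple V) : Prop :=
  uniq S /\
  forall i j : 'I_k, j = i.+1 :> nat -> E (tnth S i, tnth S j).

(* R^I with the product sigma-algebra, i.e. the one generated by the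
   coordinate maps; I may be infinite. *)
Definition product_space (R : realType) (I : Type) :=
  g_sigma_algebraType
    (\bigcup_(i in [set: I])
       preimage_set_system [set: I -> R] (fun x => x i) measurable).

Section probability_notions.
Context (R : realType) d (T : measurableType d) (P : probability T R).

(* Both sides are only compared on Borel sets: a measure is a total function
   on sets, with irrelevant values outside the sigma-algebra. *)
Definition standard_normal (Y : {mfun T >-> R}) : Prop :=
  forall B : set R, measurable B -> distribution P Y B = normal_prob 0 1 B.

(* Mutual independence of the variables (Y i) for i in D. *)
Definition mutually_independent (I : choiceType) (D : set I)
    (Y : I -> {mfun T >-> R}) : Prop :=
  forall (J : {fset I}) (B : I -> set R),
    (forall i, i \in J -> D i) ->
    (forall i, measurable (B i)) ->
    P (\bigcap_(i in [set` J]) (Y i @^-1` B i)) =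
    (\prod_(i <- J) P (Y i @^-1` B i))%E.

Definition iid_standard_normal (I : choiceType) (D : set I)
    (Y : I -> {mfun T >-> R}) : Prop :=
  (forall i, D i -> standard_normal (Y i)) /\ mutually_independent D Y.

(* The sigma-algebra generated by the subvector (Y i), i in D. *)
Definition generated_sigma (I : Type) (D : set I)
    (Y : I -> {mfun T >-> R}) : set (set T) :=
  <<s \bigcup_(i in D) preimage_set_system [set: T] (Y i) measurable >>.

Definition independent_subvectors (I : Type) (D D' : set I)
    (Y : I -> {mfun T >-> R}) : Prop :=
  forall A B : set T,
    generated_sigma D Y A -> generated_sigma D' Y B ->
    P (A `&` B) = (P A * P B)%E.

End probability_notions.

(* (Y_1, ..., Y_n) is a centered Gaussian vector: it has the same law on R^n
   as A Z for some matrix A and some vector Z of independent standard normal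
   variables, possibly on another probability space. *)
Definition centered_gaussian_vector (R : realType) d (T : measurableType d)
    (P : probability T R) (n : nat) (Y : 'I_n -> {mfun T >-> R}) : Prop :=
  exists (m : nat) (A : 'M[R]_(n, m))
         (d' : measure_display) (T' : measurableType d')
         (P' : probability T' R) (Z : 'I_m -> {mfun T' >-> R}),
    iid_standard_normal P' [set: 'I_m] Z /\
    forall B : set (product_space R 'I_n), measurable B ->
      P [set w | B (fun i => Y i w)] =
      P' [set w | B (fun i => \sum_(j < m) A i j * Z j w)].

Section models.
Context (R : realType) d (T : measurableType d) (V : choiceType).
Variable X : V -> {mfun T >-> R}.

Definition null_model (P0 : probability T R) : Prop :=
  iid_standard_normal P0 [set: V] X.

Definition path_model (k : nat) (S : k.-tuple V) (psi : R)
    (P : probability T R) : Prop :=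
  [/\ centered_gaussian_vector P (fun j : 'I_k => X (tnth S j)),
      forall i j : 'I_k,
        covariance P (X (tnth S i)) (X (tnth S j)) = (psi ^+ `|i - j|%N)%:E,
      iid_standard_normal P [set v | v \notin S] X &
      independent_subvectors P [set v | v \in S] [set v | v \notin S] X].

End models.

Definition test (R : realType) (V : Type) := {mfun product_space R V >-> bool}.

(* The maximum is taken over the finite class C; its starting value -oo is
   irrelevant as soon as C is nonempty. *)
Definition worst_case_risk (R : realType) d (T : measurableType d)
    (V : choiceType) (X : V -> {mfun T >-> R}) (k : nat)
    (P0 : probability T R) (P : k.-tuple V -> probability T R)
    (C : {fset k.-tuple V}) (f : test R V) : \bar R :=
  (P0 [set w | f (fun v => X v w) = true] +
   \big[maxe/-oo]_(S <- C) P S [set w | f (fun v => X v w) = false])%E.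

Section normal_functions.
Context {R : realType}.

Definition normal_df (x : R) : R := fine (normal_prob 0 1 `]-oo, x]).

(* The inverse function of the bijection normal_df from R onto ]0, 1[. *)
Definition normal_df_inv (p : R) : R := get [set x | normal_df x = p].

Definition p_ (t : R) : R := 2 * normal_df t - 1.

Definition h (x : R) : R := x - ln x - 1.

End normal_functions.

Definition is_largest (R : realType) (A : set R) (t : R) : Prop :=
  A t /\ forall s, A s -> s <= t.

Section path_statistic.
Context {R : realType} {V : choiceType} {k : nat}.

(* The sum ranges over the pairs of consecutive indices. *)
Definition V_ (t : R) (S : k.-tuple V) (x : V -> R) : nat :=
  (\sum_(i < k) \sum_(j < k | j == i.+1 :> nat)
     (`|x (tnth S j) - x (tnth S i)| <= Num.sqrt 2 * t)%R)%N.

Definition V_max (C : {fset k.-tuple V}) (t : R) (x : V -> R) : nat :=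
  (\max_(S <- C) V_ t S x)%N.

Definition path_test_fun (C : {fset k.-tuple V}) (t : R)
    (x : product_space R V) : bool :=
  k%:R / 2 < (V_max C t x)%:R :> R.

Lemma measurable_coordinate (v : V) :
  measurable_fun [set: product_space R V]
    (fun x : product_space R V => (x : V -> R) v).
Proof.
move=> _ B mB; rewrite setTI; apply: sub_sigma_algebra.
by exists v => //; exists B => //; rewrite setTI.
Qed.

Lemma measurable_V_ (t : R) (S : k.-tuple V) :
  measurable_fun [set: product_space R V]
    (fun x : product_space R V => (V_ t S x)%:R : R).
Proof.
pose close (i j : 'I_k) (x : product_space R V) : bool :=
  `|(x : V -> R) (tnth S j) - (x : V -> R) (tnth S i)| <= Num.sqrt 2 * t.
have mclose i j : measurable_fun [set: product_space R V]
    (fun x => if close i j x then 1 else 0 : R).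
  apply: measurable_fun_ifT; try exact: measurable_cst.
  apply: measurable_fun_ler; last exact: measurable_cst.
  apply: measurableT_comp => //.
  by apply: measurable_funB; exact: measurable_coordinate.
apply: (@eq_measurable_fun _ _ _ _ _
  (fun x => \sum_(i < k) \sum_(j < k | j == i.+1 :> nat)
              if close i j x then 1 else 0 : R)) => [x _|].
  rewrite /V_ natr_sum; apply: eq_bigr => i _.
  by rewrite natr_sum; apply: eq_bigr => j _; rewrite /close; case: ifP.
apply: measurable_sum => i.
apply: (@eq_measurable_fun _ _ _ _ _
  (fun x => \sum_(j < k) if j == i.+1 :> nat then
              (if close i j x then 1 else 0) else 0 : R)) => [x _|].
  by rewrite -big_mkcond.
apply: measurable_sum => j.
by case: (nat_of_ord j == i.+1); [exact: mclose|exact: measurable_cst].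
Qed.

Lemma measurable_path_test_fun (C : {fset k.-tuple V}) (t : R) :
  measurable_fun [set: product_space R V] (path_test_fun C t).
Proof.
have mmax (s : seq (k.-tuple V)) : measurable_fun [set: product_space R V]
    (fun x : product_space R V => (\max_(S <- s) V_ t S x)%N%:R : R).
  elim: s => [|S s IHs].
    apply: (@eq_measurable_fun _ _ _ _ _ (fun=> 0 : R)) => [x _|].
      by rewrite big_nil.
    exact: measurable_cst.
  apply: (@eq_measurable_fun _ _ _ _ _
    (fun x : product_space R V => Num.max (V_ t S x)%:R
       (\max_(S' <- s) V_ t S' x)%N%:R : R)) => [x _|].
    by rewrite big_cons /maxn /Order.max/= ltr_nat; case: ifP.
  by apply: measurable_maxr => //; exact: measurable_V_.
by apply: measurable_fun_ltr; [exact: measurable_cst|exact: mmax].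
Qed.

HB.instance Definition _ (C : {fset k.-tuple V}) (t : R) :=
  isMeasurableFun.Build _ _ _ _ (path_test_fun C t)
    (measurable_path_test_fun C t).

Definition path_test (C : {fset k.-tuple V}) (t : R) : test R V :=
  path_test_fun C t.

End path_statistic.

(* Main.v *)
Require Import Defs.
From HB Require Import structures.
From mathcomp Require Import all_boot all_order all_algebra finmap.
From mathcomp Require Import all_classical all_reals all_analysis.
From mathcomp Require Import measurable_realfun zify ring lra.

(* Under the null hypothesis, grouping the increments of X along a path by the
   parity of their index makes them involve disjoint pairs of nodes. Rotating
   each pair by an eighth of a turn keeps the family standard Gaussian and
   turns the events |X_{s_{j+1}} - X_{s_j}| <= sqrt 2 t into independent events
   of probability p_t. If V_{t,S} > k/2, one of the two groups, of size at most
   k/2, has more than k/4 successes, which by Chernoff's bound has probability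
   at most exp (- (k/4) h(2 p_t)). The union bound over the two groups and the
   class gives 2 |C| exp (- (k/4) h(2 p_t)) <= 2 exp (- k/8).

   Under the alternative, h(2 p_t) >= 1 forces 2 p_t < 1, hence t < q where
   q = N^{-1}(4/5), hence psi >= 0. The increments normalised to unit variance
   have correlations - psi^(m-1) (1 - psi) / 2 at distance m, with a summable
   bound that does not depend on psi. Two standard normal variables with
   correlation rho both lie in [-q, q] with probability at most
   p_q^2 + O(|rho|), and p_q = 3/5 > 1/2, so Chebyshev's inequality bounds
   the type II error by O(1/k). *)

Set Implicit Arguments.
Unset Strict Implicit.
Unset Printing Implicit Defensive.

Import Order.TTheory GRing.Theory Num.Theory.
Import numFieldTopology.Exports numFieldNormedType.Exports.

Local Open Scope classical_set_scope.
Local Open Scope ring_scope.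

(** * Rotation invariance of the standard Gaussian measure on the plane *)

Local Notation gauss := (normal_prob 0 1).

(** Apart from the one-dimensional density, the Gaussian facts used here come from the rotation
    invariance of the planar measure. A Gaussian vector is given only as [A Z], with [A] unknown and
    [Z] possibly on another space, so its covariances must first be recognised as inner products of
    the rows of [A]; this is what the second moment of the standard normal law is for. Plane
    rotations of the coordinates of [Z] then bring any two linear forms to [al * z1] and
    [be * z1 + de * z2], whose coefficients are tied to the inner products of the forms, so no
    density of a correlated pair is ever written. The union, Chernoff and Chebyshev bounds are all
    obtained by integrating one linear inequality between indicators. *)

Lemma integral_gauss (R : realType) (f : R -> \bar R) :
  measurable_fun [set: R] f -> (forall x, 0 <= f x)%E ->
  (\int[gauss]_x f x =
   \int[lebesgue_measure]_x (f x * (normal_pdf 0 1 x)%:E))%E.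
Proof.
move=> mf f0.
have dom : (gauss : {finite_measure set (measurableTypeR R) -> \bar R}) `<<
    (@lebesgue_measure R).
  exact: normal_prob_dominates.
have mpdf : measurable_fun [set: R] (fun x => (normal_pdf 0 1 x)%:E).
  by apply/measurable_EFinP; exact: measurable_normal_pdf.
rewrite -(Radon_Nikodym_SigmaFinite.change_of_variables dom)//.
have ig := Radon_Nikodym_SigmaFinite.f_integrable dom.
apply: ae_eq_integral => //.
- by apply: emeasurable_funM => //; exact: measurable_int ig.
- exact: emeasurable_funM.
(* The Radon-Nikodym derivative and the normal density have the same integral over every measurable
   set, hence agree almost everywhere. *)
- apply: ae_eqe_mul2l; apply: integral_ae_eq => // E _ mE.
  by rewrite -(Radon_Nikodym_SigmaFinite.f_integral dom).
Qed.

Section affine_substitution.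
Variables (R : realType) (c m : R).
Hypothesis c0 : c != 0.
Local Notation mu := (@lebesgue_measure R).

Let aff (x : measurableTypeR R) : measurableTypeR R := c * x + m.

Let measurable_aff : measurable_fun [set: R] aff.
Proof. by apply: measurable_funD => //; exact: measurable_funM. Qed.

Let mu_aff : {measure set (measurableTypeR R) -> \bar R}.
Proof.
by refine (pushforward mu aff : {measure set _ -> \bar R});
  exact: measurable_aff.
Defined.

(** Lebesgue measure is determined by its values on the intervals []a, b]]. For negative [c] the
    preimage of such an interval is closed on the left instead, which leaves its length
    unchanged. *)
Let lebesgue_measure_affine (A : set R) : measurable A ->
  mu A = (`|c|%:E * mu_aff A)%E.
Proof.
have c_ge0 : 0 <= `|c| by [].
pose mc := mscale (NngNum c_ge0) mu_aff.
suff: forall A, measurable A -> mu A = mc A by apply.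
apply: lebesgue_measure_unique => _ [[a b] _ <-].
change (mu `]a, b] = `|c|%:E * mu (aff @^-1` `]a, b]))%E.
have [cp|cn|/esym] := ltgtP 0 c; last by move=> /eqP; rewrite (negbTE c0).
- have -> : aff @^-1` `]a, b] = `](a - m) / c, (b - m) / c]%classic.
    apply/seteqP; split => x; rewrite /aff/= !in_itv/=.
      by rewrite ltr_pdivrMr// ler_pdivlMr// [x * c]mulrC ltrBlDr lerBrDr.
    by rewrite ltr_pdivrMr// ler_pdivlMr// [x * c]mulrC ltrBlDr lerBrDr.
  rewrite !lebesgue_measure_itv/= !lte_fin ltr_pM2r ?invr_gt0// ltrD2r.
  case: ifPn => ab; last by rewrite mule0.
  by rewrite -!EFinD -EFinM gtr0_norm//; congr EFin; field.
- have -> : aff @^-1` `]a, b] = `[(b - m) / c, (a - m) / c[%classic.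
    apply/seteqP; split => x; rewrite /aff/= !in_itv/=.
      by rewrite ltr_ndivlMr// ler_ndivrMr// [x * c]mulrC ltrBlDr lerBrDr andbC.
    by rewrite ltr_ndivlMr// ler_ndivrMr// [x * c]mulrC ltrBlDr lerBrDr andbC.
  rewrite !lebesgue_measure_itv/= !lte_fin ltr_nM2r ?invr_lt0// ltrD2r.
  case: ifPn => ab; last by rewrite mule0.
  by rewrite -!EFinD -EFinM ltr0_norm//; congr EFin; field.
Qed.

Lemma integral_affine (f : R -> \bar R) :
  measurable_fun [set: R] f -> (forall x, 0 <= f x)%E ->
  (\int[mu]_x f x = \int[mu]_x (`|c|%:E * f (c * x + m)%R))%E.
Proof.
move=> mf f0.
have c_ge0 : 0 <= `|c| by [].
have mfa : measurable_fun [set: R] (fun x => f (c * x + m)).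
  exact: (measurableT_comp mf measurable_aff).
rewrite ge0_integralZl//.
transitivity (\int[mscale (NngNum c_ge0) mu_aff]_x f x)%E.
  by apply: eq_measure_integral => A mA _; exact: lebesgue_measure_affine.
rewrite ge0_integral_mscale//=; congr (_ * _)%E.
by rewrite ge0_integral_pushforward// preimage_setT.
Qed.

End affine_substitution.

Section gauss_rotation.
Variable R : realType.
Local Notation gauss2 := ((@normal_prob R 0 1) \x (@normal_prob R 0 1))%E.
Local Notation mu := (@lebesgue_measure R).
Local Notation phi := (@normal_pdf R 0 1).

Definition rotation (c s : R) (z : R * R) : R * R :=
  (c * z.1 + s * z.2, c * z.2 - s * z.1).

Lemma measurable_lin2 (a b : R) :
  measurable_fun [set: R * R] (fun z : R * R => a * z.1 + b * z.2).
Proof. by apply: measurable_funD; apply: measurable_funM. Qed.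

Lemma measurable_rotation (c s : R) : measurable_fun [set: R * R] (rotation c s).
Proof.
apply/measurable_fun_pairP; split; first exact: measurable_lin2.
apply: (eq_measurable_fun (fun z : R * R => - s * z.1 + c * z.2)) => [z _|].
  by rewrite /rotation/= mulNr addrC.
exact: measurable_lin2.
Qed.

(** This shape is general enough to cover both integrands [f1] and [f2] met in the substitutions
    below. *)
Let measurable_density (G : set (R * R)) (a b a' b' e e' f f' k : R) :
  measurable G ->
  measurable_fun [set: R * R] (fun z : R * R =>
    (k * (\1_G (a * z.1 + b * z.2, a' * z.1 + b' * z.2) *
      (phi (e * z.1 + f * z.2) * phi (e' * z.1 + f' * z.2))))%:E).
Proof.
move=> mG; apply/measurable_EFinP; apply: measurable_funM => //.
apply: measurable_funM.
  apply: (measurableT_comp (measurable_indic mG)).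
  by apply/measurable_fun_pairP; split; exact: measurable_lin2.
by apply: measurable_funM; apply: (measurableT_comp (measurable_normal_pdf 0 1));
  exact: measurable_lin2.
Qed.

Let gauss2E (G : set (R * R)) : measurable G ->
  (gauss2 G = \int[mu]_x \int[mu]_y (\1_G (x, y) * (phi x * phi y))%:E)%E.
Proof.
move=> mG; rewrite /product_measure1.
have mxs x : measurable_fun [set: R] (fun y => (\1_G (x, y) : R)%:E).
  apply/measurable_EFinP; apply: (measurableT_comp (measurable_indic mG)).
  exact: pair1_measurable.
have mxphi x : measurable_fun [set: R] (fun y => (\1_G (x, y) * phi y)%:E).
  apply/measurable_EFinP; apply: measurable_funM; last exact: measurable_normal_pdf.
  by apply: (measurableT_comp (measurable_indic mG)); exact: pair1_measurable.
have E x : gauss (xsection G x) = (\int[mu]_y (\1_G (x, y) * phi y)%:E)%E.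
  transitivity (\int[gauss]_y (\1_G (x, y))%:E)%E.
    by rewrite -[LHS]/((gauss \o xsection G) x) -indic_fubini_tonelli_FE.
  by rewrite integral_gauss.
rewrite integral_gauss//=; last exact: measurable_fun_xsection.
apply: eq_integral => x _; rewrite E muleC -ge0_integralZl//=.
- by apply: eq_integral => y _; rewrite -EFinM mulrCA.
- exact: mxphi.
- by move=> y _; rewrite lee_fin mulr_ge0// normal_pdf_ge0.
- by rewrite lee_fin normal_pdf_ge0.
Qed.

Let phi2_rot (c s u v : R) : c ^+ 2 + s ^+ 2 = 1 ->
  phi (c * u - s * v) * phi (s * u + c * v) = phi u * phi v.
Proof.
move=> cs; rewrite !normal_pdfE ?oner_neq0// /normal_fun.
rewrite mulrACA [RHS]mulrACA -!expRD; congr (_ * expR _).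
rewrite -!mulrDl; congr (_ / _).
rewrite !subr0 -!opprD; congr (- _).
transitivity ((c ^+ 2 + s ^+ 2) * (u ^+ 2 + v ^+ 2)); first ring.
by rewrite cs mul1r.
Qed.

(* The rotation is the composition of the substitutions x = (u - s y) / c at
   fixed y and y = c v + s u at fixed u, of Jacobians 1 / c and c. *)
Let gauss2_rotation_neq0 (c s : R) (G : set (R * R)) :
  c != 0 -> c ^+ 2 + s ^+ 2 = 1 -> measurable G ->
  gauss2 (rotation c s @^-1` G) = gauss2 G.
Proof.
move=> c0 cs mG.
have s2 : s ^+ 2 = 1 - c ^+ 2 by rewrite -cs addrC addKr.
pose f1 z := (\1_G (c * z.1 + s * z.2, - s * z.1 + c * z.2) *
  (phi z.1 * phi z.2))%:E.
pose f2 z := (`|c^-1| * (\1_G (z.1, (z.2 - s * z.1) / c) *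
  (phi ((z.1 - s * z.2) / c) * phi z.2)))%:E.
have mf1 : measurable_fun [set: R * R] f1.
  apply: (eq_measurable_fun _ _ (measurable_density c s (- s) c 1 0 0 1 1 mG)) => z _.
  by rewrite /f1 !mul1r !mul0r add0r addr0.
have mf2 : measurable_fun [set: R * R] f2.
  apply: (eq_measurable_fun _ _ (measurable_density 1 0 (- s / c) c^-1
    c^-1 0 (- s / c) 1 `|c^-1| mG)) => z _.
  rewrite /f2 !mul1r !mul0r !addr0; congr (_ * (\1_G (_, _) * (phi _ * phi _)))%:E.
  - by field.
  - by field.
  - by ring.
have f1_ge0 z : (0 <= f1 z)%E.
  by rewrite lee_fin !mulr_ge0// normal_pdf_ge0.
have f2_ge0 z : (0 <= f2 z)%E.
  by rewrite lee_fin !mulr_ge0// normal_pdf_ge0.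
rewrite (gauss2E mG) gauss2E; last first.
  by rewrite -[X in measurable X]setTI; exact: measurable_rotation.
transitivity (\int[mu]_x \int[mu]_y f1 (x, y))%E.
  apply: eq_integral => x _; apply: eq_integral => y _.
  rewrite /f1/= /rotation/= mulNr [- _ + _]addrC !indicE.
  by congr (((_ : bool)%:R * _)%:E); apply/idP/idP; rewrite !inE.
rewrite (fubini_tonelli (m1 := mu) (m2 := mu) f1 mf1 f1_ge0).
transitivity (\int[mu]_y \int[mu]_x f2 (x, y))%E.
  apply: eq_integral => y _.
  rewrite (integral_affine (- s * y / c) (invr_neq0 c0)
    (measurableT_comp mf1 (pair2_measurable y))); last by move=> ?; exact: f1_ge0.
  apply: eq_integral => x _; rewrite /f1 /f2 -EFinM/=.
  congr (_ * (\1_G (_, _) * (phi _ * phi _)))%:E.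
  - by field.
  - rewrite mulrDr.
    transitivity ((c ^+ 2 + s ^+ 2) * y / c - s * x / c); first by field.
    by rewrite cs mul1r mulrBl.
  - by field.
rewrite -(fubini_tonelli (m1 := mu) (m2 := mu) f2 mf2 f2_ge0).
apply: eq_integral => u _.
rewrite (integral_affine (s * u) c0
  (measurableT_comp mf2 (pair1_measurable u))); last by move=> ?; exact: f2_ge0.
apply: eq_integral => v _; rewrite /f2 -EFinM/=.
rewrite (mulrA `|c| `|c^-1|) -normrM divff// normr1 mul1r.
rewrite -(phi2_rot u v cs); congr (\1_G (_, _) * (phi _ * phi _))%:E.
- by field.
- apply: (mulIf c0); rewrite divfK//.
  transitivity ((1 - s ^+ 2) * u - s * c * v); first ring.
  by rewrite s2; ring.
- by rewrite addrC.
Qed.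

Lemma gauss2_rotation (c s : R) (G : set (R * R)) :
  c ^+ 2 + s ^+ 2 = 1 -> measurable G ->
  gauss2 (rotation c s @^-1` G) = gauss2 G.
Proof.
move=> cs mG; have [c0|] := eqVneq c 0; last by move=> ?; exact: gauss2_rotation_neq0.
pose r : R := (Num.sqrt 2)^-1.
have r0 : r != 0 by rewrite invr_neq0// gt_eqF// sqrtr_gt0.
have r2 : r ^+ 2 = 2^-1 by rewrite exprVn sqr_sqrtr.
have s2 : s ^+ 2 = 1 by rewrite -cs c0 expr0n add0r.
have rs : r ^+ 2 + (r * s) ^+ 2 = 1 by rewrite exprMn s2 mulr1 r2; field.
(* A quarter turn is twice an eighth of a turn. *)
have -> : rotation c s = rotation r (r * s) \o rotation r (r * s).
  apply/funext => z; rewrite /rotation/= c0.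
  congr pair.
    transitivity (r ^+ 2 * (1 - s ^+ 2) * z.1 + r ^+ 2 * 2 * s * z.2); last ring.
    by rewrite s2 r2; field.
  transitivity (r ^+ 2 * (1 - s ^+ 2) * z.2 - r ^+ 2 * 2 * s * z.1); last ring.
  by rewrite s2 r2; field.
rewrite comp_preimage !gauss2_rotation_neq0//.
by rewrite -[X in measurable X]setTI; exact: measurable_rotation.
Qed.

End gauss_rotation.

(** * Product laws and Gaussian moments *)

(** Integration of a pointwise inequality. The weights may be negative: unit weights give a union
    bound, the expansion of a product gives Chernoff's bound, that of a square gives Chebyshev's. *)
Lemma weighted_union_bound d (T : measurableType d) (R : realType)
    (P : probability T R) (I : Type) (s : seq I) (c : I -> R) (E : I -> set T)
    (b : R) (B : set T) :
  measurable B -> (forall i, measurable (E i)) ->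
  (forall w, b * \1_B w <= \sum_(i <- s) c i * \1_(E i) w) ->
  b * fine (P B) <= \sum_(i <- s) c i * fine (P (E i)).
Proof.
move=> mB mE bB.
have intI (r : R) (D : set T) : measurable D ->
    P.-integrable [set: T] (fun w => (r * \1_D w)%:E).
  move=> mD; under eq_fun do rewrite EFinM.
  by apply: integrableZl => //; exact: integrable_indic.
have intE (r : R) (D : set T) : measurable D ->
    (\int[P]_w (r * \1_D w)%:E = (r * fine (P D))%:E)%E.
  move=> mD; under eq_integral do rewrite EFinM.
  rewrite integralZl//; last exact: integrable_indic.
  by rewrite integral_indic// setIT EFinM fineK// fin_num_measure.
rewrite -lee_fin -intE// -sumEFin.
under eq_bigr do rewrite -intE//.
rewrite -integral_sum//; last by move=> i; exact: intI.
apply: le_integral => //; first exact: intI.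
  by apply: integrable_sum => // i _; exact: intI.
by move=> w _; rewrite sumEFin lee_fin.
Qed.

Section product_law.
Context d d1 d2 (T : measurableType d) (T1 : measurableType d1)
  (T2 : measurableType d2) (R : realType).
Variables (P : probability T R) (m1 : probability T1 R) (m2 : probability T2 R).
Variables (U : T -> T1) (W : T -> T2) (F : set T).
Hypotheses (mU : measurable_fun [set: T] U) (mW : measurable_fun [set: T] W).
Hypothesis mF : measurable F.

Let UW w := (U w, W w).

Let measurable_UW : measurable_fun [set: T] UW.
Proof. exact/measurable_fun_pairP. Qed.

Let restricted_law : {measure set (T1 * T2) -> \bar R}.
Proof.
by refine (pushforward (mrestr P mF) UW : {measure set _ -> \bar R});
  exact: measurable_UW.
Defined.

(** Conditionally on [F], the pair has law [m1 \x m2]: its law restricted to [F] and divided by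
    [P F] agrees with the product measure on rectangles, which determine it. In the application, [F]
    carries the constraints on the other coordinates. *)
Lemma product_law :
  (forall A B, measurable A -> measurable B ->
    P (F `&` (U @^-1` A `&` W @^-1` B)) = (P F * (m1 A * m2 B))%E) ->
  forall G, measurable G -> P (F `&` UW @^-1` G) = (P F * (m1 \x m2) G)%E.
Proof.
move=> PUW G mG.
have mUWG : measurable (UW @^-1` G).
  by rewrite -[X in measurable X]setTI; exact: measurable_UW.
(* A null [F] cannot be normalised, but then both sides vanish. *)
have [PF0|PF0] := eqVneq (P F) 0%E.
  rewrite PF0 mul0e; apply/eqP; rewrite eq_le measure_ge0 andbT -PF0.
  by apply: le_measure; rewrite ?inE//; exact: measurableI.
have PFfin : P F \is a fin_num by exact: fin_num_measure.
have f0 : 0 < fine (P F) by rewrite fine_gt0// lt0e PF0 measure_ge0 ltey_eq PFfin.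
have fi0 : 0 <= (fine (P F))^-1 by rewrite invr_ge0 ltW.
pose m' := mscale (NngNum fi0) restricted_law.
have PK x : ((fine (P F))^-1%:E * (P F * x) = x)%E.
  by rewrite muleA -[X in (_ * X * _)%E]fineK// -EFinM mulVf ?mul1e// gt_eqF.
have -> : ((m1 \x m2) G = m' G)%E.
  apply: product_measure_unique => // A B mA mB.
  rewrite -[RHS]PK -PUW//; congr (_ * P _)%E.
  by apply/seteqP; split => w /=; rewrite /UW/=; tauto.
rewrite -[LHS](PK _) muleCA; congr (_ * _)%E.
rewrite /m' /mscale/= ; congr (_ * _)%E.
by rewrite /restricted_law /pushforward /mrestr setIC.
Qed.

End product_law.

Section gauss_moments.
Variable R : realType.
Local Notation gaussR := (@normal_prob R 0 1).
Local Notation mu := (@lebesgue_measure R).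

Let tilt (s x : R) := expR (x ^+ 2 / 2 * (1 - s ^- 2)).

Let measurable_tilt s : measurable_fun [set: R] (tilt s).
Proof.
apply: measurableT_comp => //; apply: measurable_funM => //.
by apply: measurable_funM => //; exact: measurable_funX.
Qed.

Let integral_tilt (s : R) : 0 < s -> (\int[gaussR]_x (tilt s x)%:E = s%:E)%E.
Proof.
move=> s0; have sn0 : s != 0 by rewrite gt_eqF.
have mt : measurable_fun [set: R] (fun x => (tilt s x)%:E).
  by apply/measurable_EFinP; exact: measurable_tilt.
rewrite integral_gauss//; last by move=> x; rewrite lee_fin expR_ge0.
transitivity (\int[mu]_x (s%:E * (normal_pdf 0 s x)%:E))%E.
  apply: eq_integral => x _; rewrite -!EFinM; congr EFin.
  rewrite !normal_pdfE ?oner_neq0// /tilt /normal_fun mulrCA -expRD mulrA.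
  congr (_ * expR _); last by rewrite !subr0; field.
  rewrite /normal_peak expr1n mul1r -!mulrnAr sqrtrM ?sqr_ge0// sqrtr_sqr gtr0_norm//.
  by rewrite invfM mulrA mulfV// mul1r.
rewrite ge0_integralZl//.
- by rewrite integral_normal_pdf mule1.
- by apply/measurable_EFinP; exact: measurable_normal_pdf.
- by move=> x _; rewrite lee_fin normal_pdf_ge0.
- by rewrite lee_fin ltW.
Qed.

Let m2 := (\int[gaussR]_x (x ^+ 2)%:E)%E.

Let msqr : measurable_fun [set: R] (fun x => (x ^+ 2)%:E).
Proof. by apply/measurable_EFinP; exact: measurable_funX. Qed.

Let sqr_ge0E (x : R) : (0 <= (x ^+ 2)%:E)%E.
Proof. by rewrite lee_fin sqr_ge0. Qed.

Let m2_ge0 : (0 <= m2)%E.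
Proof. by apply: integral_ge0 => x _; exact: sqr_ge0E. Qed.

Let integral_affine_sqr (k l : R) : 0 <= k -> 0 <= l ->
  (\int[gaussR]_x (k + l * x ^+ 2)%:E = k%:E + l%:E * m2)%E.
Proof.
move=> k0 l0; under eq_integral do rewrite EFinD EFinM.
rewrite ge0_integralD//; last 2 first.
  by move=> x _; rewrite mule_ge0.
  exact: measurable_funeM.
by rewrite integral_cst//= probability_setT mule1 ge0_integralZl.
Qed.

(* tilt s is, up to the factor s, the density of N(0, s^2) relative to N(0, 1).
   Bounding it below by its linearisation and letting s tend to 1 from both
   sides gives the second moment. *)
Let m2_le (s : R) : 1 < s -> (1 + ((1 - s ^- 2) / 2)%:E * m2 <= s%:E)%E.
Proof.
move=> s1; have s0 : 0 < s by rewrite (lt_trans _ s1).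
have k0 : 0 <= (1 - s ^- 2) / 2.
  by rewrite divr_ge0// subr_ge0 invf_le1 ?exprn_gt0// exprn_ege1// ltW.
rewrite -integral_affine_sqr// -(integral_tilt s0).
apply: ge0_le_integral => //.
- by move=> x _; rewrite lee_fin addr_ge0// mulr_ge0// sqr_ge0.
- apply/measurable_EFinP/measurable_funD => //.
  by apply: measurable_funM => //; exact: measurable_funX.
- by apply/measurable_EFinP; exact: measurable_tilt.
- move=> x _; rewrite lee_fin; apply: le_trans (expR_ge1Dx _).
  by move: (s ^- 2) => v; lra.
Qed.

Let m2_ge (s : R) : 0 < s -> s < 1 -> (1 <= s%:E + ((s ^- 2 - 1) / 2)%:E * m2)%E.
Proof.
move=> s0 s1.
have k0 : 0 <= (s ^- 2 - 1) / 2.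
  by rewrite divr_ge0// subr_ge0 invf_ge1 ?exprn_gt0// exprn_ile1// ltW.
have mt : measurable_fun [set: R] (fun x => (tilt s x)%:E).
  by apply/measurable_EFinP; exact: measurable_tilt.
have t0 x : (0 <= (tilt s x)%:E)%E by rewrite lee_fin expR_ge0.
rewrite -(integral_tilt s0) -ge0_integralZl// -ge0_integralD//; last 2 first.
  by move=> x _; rewrite mule_ge0.
  exact: measurable_funeM.
rewrite -[X in (X <= _)%E](@probability_setT _ _ _ gaussR).
rewrite -[X in (X <= _)%E]mul1e -integral_cst//.
apply: ge0_le_integral => //.
- by apply: emeasurable_funD => //; exact: measurable_funeM.
- move=> x _; rewrite -EFinM -EFinD lee_fin -lerBlDr.
  apply: le_trans (expR_ge1Dx _).
  by move: (s ^- 2) => v; lra.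
Qed.

Lemma integral_gauss_sqr : (\int[gaussR]_x (x ^+ 2)%:E = 1)%E.
Proof.
rewrite -/m2.
(* At [s = 2] the upper inequality has a positive coefficient on [m2] and a finite right-hand side,
   so [m2] cannot be infinite. *)
have m2fin : m2 \is a fin_num.
  rewrite ge0_fin_numE//; have /= := @m2_le 2 _; rewrite ltr1n => /(_ isT).
  case: (m2) m2_ge0 => [r _ _|_|//]; first by rewrite ltry.
  rewrite gt0_muley ?addey// lte_fin divr_gt0// subr_gt0 invf_lt1//.
  by rewrite exprn_egt1 ?ltr1n.
have mE : m2 = (fine m2)%:E by rewrite fineK.
set c := fine m2 in mE.
rewrite mE; congr EFin; apply/eqP; rewrite eq_le; apply/andP; split.
- apply/ler_addgt0Pr => e e0.
  (* With [s = 1 + u] the inequality reads [c <= 2 (1 + u)^2 / (2 + u)], which is at most [1 + 2 u],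
     hence at most [1 + e]. The other side is symmetric, with [s = 1 - u]. *)
  pose u := Num.min 1 (e / 2).
  have u0 : 0 < u by rewrite lt_min ltr01 divr_gt0.
  have u1 : u <= 1 by rewrite ge_min lexx.
  have ue : 2 * u <= e by rewrite mulrC -ler_pdivlMr// ge_min lexx orbT.
  have := @m2_le (1 + u); rewrite ltrDl => /(_ u0).
  rewrite mE -EFinM -EFinD lee_fin => H.
  apply: (@le_trans _ _ (1 + 2 * u)); last by rewrite lerD2l.
  have s0 : 0 < 1 + u by lra.
  have {}H : u * (2 + u) * c <= u * (2 * (1 + u) ^+ 2).
    have : ((1 - (1 + u) ^- 2) / 2 * c) * (2 * (1 + u) ^+ 2) <= u * (2 * (1 + u) ^+ 2).
      by rewrite ler_pM2r; [lra|rewrite mulr_gt0// exprn_gt0].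
    apply: le_trans; rewrite le_eqVlt; apply/orP; left; apply/eqP.
    by field; rewrite gt_eqF.
  rewrite -mulrA ler_pM2l// in H.
  nra.
- apply/ler_addgt0Pr => e e0.
  pose u := Num.min (1 / 2) (e / 2).
  have u0 : 0 < u by rewrite lt_min; apply/andP; split; lra.
  have u1 : u <= 1 / 2 by rewrite ge_min lexx.
  have ue : 2 * u <= e by rewrite mulrC -ler_pdivlMr// ge_min lexx orbT.
  have s0 : 0 < 1 - u by lra.
  have := @m2_ge (1 - u) s0; rewrite gtrBl => /(_ u0).
  rewrite mE -EFinM -EFinD lee_fin => H.
  apply: (@le_trans _ _ (c + 2 * u)); last by rewrite lerD2l.
  have {}H : u * (2 * (1 - u) ^+ 2) <= u * (2 - u) * c.
    have : u * (2 * (1 - u) ^+ 2) <= (((1 - u) ^- 2 - 1) / 2 * c) * (2 * (1 - u) ^+ 2).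
      by rewrite ler_pM2r; [lra|rewrite mulr_gt0// exprn_gt0].
    move=> /le_trans; apply; rewrite le_eqVlt; apply/orP; left; apply/eqP.
    by field; rewrite gt_eqF.
  rewrite -mulrA ler_pM2l// in H.
  nra.
Qed.

End gauss_moments.

(** * Linear forms in independent standard normal variables *)

Section gaussian_families.
Context d (T : measurableType d) (R : realType) (P : probability T R).
Local Notation gauss2 := ((@normal_prob R 0 1) \x (@normal_prob R 0 1))%E.
Variable I : finType.
Implicit Types (Z : I -> T -> R) (u v : I -> R).

(** Over a finite index set the full product formula suffices: subfamilies are reached by taking
    some [B i] to be the whole line. *)
Definition iid_gauss Z : Prop :=
  (forall i, measurable_fun [set: T] (Z i)) /\
  forall B : I -> set R, (forall i, measurable (B i)) ->
    P (\bigcap_(i in [set: I]) Z i @^-1` B i) = (\prod_i gauss (B i))%E.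

Definition dot v Z (w : T) : R := \sum_i v i * Z i w.

Definition inner u v : R := \sum_i u i * v i.

Definition rotate_family (i j : I) (c s : R) Z (l : I) (w : T) : R :=
  if l == i then c * Z i w + s * Z j w
  else if l == j then c * Z j w - s * Z i w else Z l w.

Definition rotate_vec (i j : I) (c s : R) v (l : I) : R :=
  if l == i then c * v i + s * v j
  else if l == j then c * v j - s * v i else v l.

(** Keeping the constraints on the other coordinates is what makes the whole family, and not just
    the pair, independent again after a rotation of the pair. *)
Lemma iid_gauss_pair Z i j : iid_gauss Z -> i != j ->
  forall B (G : set (R * R)), (forall l, measurable (B l)) -> measurable G ->
  P ((\bigcap_(l in [set l | l != i /\ l != j]) Z l @^-1` B l) `&`
      (fun w => (Z i w, Z j w)) @^-1` G) =
  (\prod_(l | (l != i) && (l != j)) gauss (B l) * gauss2 G)%E.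
Proof.
move=> [mZ iZ] ij B G mB mG.
pose B' A A' l := if l == i then A else if l == j then A' else B l.
have ji : (j == i) = false by rewrite eq_sym (negbTE ij).
have mB' A A' l : measurable A -> measurable A' -> measurable (B' A A' l).
  by move=> mA mA'; rewrite /B'; case: ifP => // _; case: ifP.
set F := \bigcap_(l in _) _.
have FE A A' : F `&` (Z i @^-1` A `&` Z j @^-1` A') =
    \bigcap_(l in [set: I]) Z l @^-1` B' A A' l.
  apply/seteqP; split => w.
    move=> [Fw [Aw A'w]] l _; rewrite /B' /=.
    case: eqVneq => [->//|li]; case: eqVneq => [->//|lj].
    by apply: Fw; split.
  move=> H; split; [|split].
  - by move=> l [/negbTE li /negbTE lj]; have := H l Logic.I; rewrite /B'/= li lj.
  - by have := H i Logic.I; rewrite /B'/= eqxx.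
  - by have := H j Logic.I; rewrite /B'/= eqxx ji.
have PFE A A' : measurable A -> measurable A' ->
    P (F `&` (Z i @^-1` A `&` Z j @^-1` A')) =
    (\prod_(l | (l != i) && (l != j)) gauss (B l) * (gauss A * gauss A'))%E.
  move=> mA mA'; rewrite FE iZ; last by move=> l; exact: mB'.
  rewrite (bigD1 i)//= (bigD1 j)/=; last by rewrite eq_sym.
  rewrite /B' eqxx ji eqxx muleA muleC; congr (_ * _)%E.
  by apply: eq_bigr => l /andP[/negbTE -> /negbTE ->].
have PF : P F = (\prod_(l | (l != i) && (l != j)) gauss (B l))%E.
  have := PFE setT setT measurableT measurableT.
  by rewrite !preimage_setT !setIT !probability_setT !mule1.
have mF : measurable F.
  have := FE setT setT; rewrite !preimage_setT !setIT => ->.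
  apply: fin_bigcap_measurable => // l _; rewrite -[X in measurable X]setTI.
  by apply: mZ => //; exact: mB'.
rewrite -PF; apply: (product_law (m1 := gauss) (m2 := gauss) (mZ i) (mZ j) mF) => //.
by move=> A A' mA mA'; rewrite PFE// PF.
Qed.

Lemma iid_gauss_rotate Z i j c s : iid_gauss Z -> i != j ->
  c ^+ 2 + s ^+ 2 = 1 -> iid_gauss (rotate_family i j c s Z).
Proof.
move=> iZ ij cs; have [mZ _] := iZ.
have ji : (j == i) = false by rewrite eq_sym (negbTE ij).
split.
  move=> l; rewrite /rotate_family; case: (l == i).
    by apply: measurable_funD; exact: measurable_funM.
  case: (l == j); last exact: mZ.
  by apply: measurable_funB; exact: measurable_funM.
move=> B mB.
have -> : \bigcap_(l in [set: I]) rotate_family i j c s Z l @^-1` B l =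
    (\bigcap_(l in [set l | l != i /\ l != j]) Z l @^-1` B l) `&`
      (fun w => (Z i w, Z j w)) @^-1` (rotation c s @^-1` (B i `*` B j)).
  apply/seteqP; split => w.
    move=> H; split.
      move=> l [/negbTE li /negbTE lj].
      by have := H l Logic.I; rewrite /rotate_family /= li lj.
    split; first by have := H i Logic.I; rewrite /rotate_family /= eqxx.
    by have := H j Logic.I; rewrite /rotate_family /= eqxx ji.
  move=> [H [/= Hi Hj]] l _; rewrite /rotate_family /=.
  case: eqVneq => [->//|li]; case: eqVneq => [->//|lj].
  by apply: H; split.
rewrite iid_gauss_pair//; last first.
  rewrite -[X in measurable X]setTI.
  by apply: measurable_rotation => //; exact: measurableX.
rewrite gauss2_rotation//; last exact: measurableX.
rewrite product_measure1E; [|exact: mB|exact: mB].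
rewrite [RHS](bigD1 i)//= [in RHS](bigD1 j)/=; last by rewrite eq_sym.
by rewrite muleA muleC.
Qed.

Lemma sum_rotate (f g : I -> R) i j : i != j ->
  (forall l, l != i -> l != j -> f l = g l) -> f i + f j = g i + g j ->
  \sum_l f l = \sum_l g l.
Proof.
move=> ij fg fgij.
rewrite (bigD1 i)//= (bigD1 j)/=; last by rewrite eq_sym.
rewrite [RHS](bigD1 i)//= [in RHS](bigD1 j)/=; last by rewrite eq_sym.
rewrite !addrA fgij; congr (_ + _).
by apply: eq_bigr => l /andP[li lj]; exact: fg.
Qed.

Lemma dot_rotate Z v i j c s w : i != j -> c ^+ 2 + s ^+ 2 = 1 ->
  dot (rotate_vec i j c s v) (rotate_family i j c s Z) w = dot v Z w.
Proof.
move=> ij cs; apply: (sum_rotate ij) => [l /negbTE li /negbTE lj|].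
  by rewrite /rotate_vec /rotate_family li lj.
rewrite /rotate_vec /rotate_family !eqxx eq_sym (negbTE ij).
transitivity ((c ^+ 2 + s ^+ 2) * (v i * Z i w + v j * Z j w)); first ring.
by rewrite cs mul1r.
Qed.

Lemma inner_rotate u v i j c s : i != j -> c ^+ 2 + s ^+ 2 = 1 ->
  inner (rotate_vec i j c s u) (rotate_vec i j c s v) = inner u v.
Proof.
move=> ij cs; apply: (sum_rotate ij) => [l /negbTE li /negbTE lj|].
  by rewrite /rotate_vec li lj.
rewrite /rotate_vec !eqxx eq_sym (negbTE ij).
transitivity ((c ^+ 2 + s ^+ 2) * (u i * v i + u j * v j)); first ring.
by rewrite cs mul1r.
Qed.

(** A Givens rotation: [(c, s)] is the direction of [(v i, v j)], or the identity when both entries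
    vanish. *)
Lemma rotate_vec_annihilate v i j : i != j ->
  exists c s, c ^+ 2 + s ^+ 2 = 1 /\ rotate_vec i j c s v j = 0.
Proof.
move=> ij; rewrite /rotate_vec eq_sym (negbTE ij) eqxx.
have [r0|r0] := eqVneq (v i ^+ 2 + v j ^+ 2) 0.
  exists 1, 0; rewrite expr1n expr0n addr0; split => //.
  move/eqP : r0; rewrite paddr_eq0 ?sqr_ge0// !sqrf_eq0 => /andP[_ /eqP ->].
  by rewrite mulr0 mul0r subrr.
have n0 : 0 <= v i ^+ 2 + v j ^+ 2 by rewrite addr_ge0// sqr_ge0.
pose r := Num.sqrt (v i ^+ 2 + v j ^+ 2).
exists (v i / r), (v j / r); split; last by ring.
by rewrite !expr_div_n -mulrDl sqr_sqrtr// divff.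
Qed.

(** Givens rotations with pivot [i] clear the entries of [v] on [L] one by one. [M] is the resulting
    orthogonal map on coefficients; its last property lets a second reduction, with another pivot,
    preserve what the first one achieved. *)
Lemma iid_gauss_reduce Z v i (L : seq I) : iid_gauss Z -> i \notin L ->
  exists Z' (M : (I -> R) -> I -> R),
    [/\ iid_gauss Z', (forall u w, dot (M u) Z' w = dot u Z w),
        (forall u u', inner (M u) (M u') = inner u u'),
        (forall l, l \in L -> M v l = 0) &
        (forall u, u i = 0 -> (forall l, l \in L -> u l = 0) -> M u = u)].
Proof.
move=> iZ; elim: L => [|j L IH]; first by move=> _; exists Z, id; split.
rewrite inE negb_or => /andP[ij iL].
have [Z' [M [iZ' MZ MM Mv Mu]]] := IH iL.
have [c [s [cs vj]]] := rotate_vec_annihilate (M v) ij.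
exists (rotate_family i j c s Z'), (fun u => rotate_vec i j c s (M u)); split.
- exact: iid_gauss_rotate.
- by move=> u w; rewrite dot_rotate.
- by move=> u u'; rewrite inner_rotate.
- move=> l; rewrite inE => /orP[/eqP ->//|lL].
  have [->//|lj] := eqVneq l j.
  have /negbTE li : l != i by apply: contraNneq iL => <-.
  by rewrite /rotate_vec (negbTE lj) li Mv.
- move=> u ui uL; rewrite Mu//; last by move=> l lL; rewrite uL// inE lL orbT.
  have uj : u j = 0 by rewrite uL// inE eqxx.
  apply/funext => l; rewrite /rotate_vec ui uj !mulr0 addr0 subrr.
  by have [->//|_] := eqVneq l i; have [->|_] := eqVneq l j.
Qed.

(** A triangular reduction: [u] is concentrated on [i], then [v] on [i] and [j]. The numbers [al],
    [be], [de] are the entries of a Cholesky factor of the Gram matrix of [u] and [v]. *)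
Lemma iid_gauss_law2 Z (i j : I) : iid_gauss Z -> i != j -> forall u v,
  exists al be de, [/\ al ^+ 2 = inner u u, al * be = inner u v,
    be ^+ 2 + de ^+ 2 = inner v v &
    forall G : set (R * R), measurable G ->
      P [set w | G (dot u Z w, dot v Z w)] =
      gauss2 [set z | G (al * z.1, be * z.1 + de * z.2)]].
Proof.
move=> iZ ij u v.
pose L := [seq l <- enum I | l != i].
have iL : i \notin L by rewrite mem_filter eqxx.
have [Z1 [M1 [iZ1 dZ1 pM1 M1u _]]] := iid_gauss_reduce u iZ iL.
pose K := [seq l <- L | l != j].
have jK : j \notin K by rewrite mem_filter eqxx.
have [Z2 [M2 [iZ2 dZ2 pM2 M2v M2u]]] := iid_gauss_reduce (M1 v) iZ1 jK.
have inL l : l != i -> l \in L by move=> li; rewrite mem_filter li mem_enum.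
have ji : j != i by rewrite eq_sym.
(* The first vector now lives on [i] alone, which is neither the second pivot nor an entry to be
   cleared. *)
have M2E : M2 (M1 u) = M1 u.
  apply: M2u; first by rewrite M1u// inL.
  by move=> l; rewrite mem_filter => /andP[_ lL]; rewrite M1u.
pose a := M1 u; pose b := M2 (M1 v).
have a0 l : l != i -> a l = 0 by move=> li; rewrite /a M1u// inL.
have b0 l : l != i -> l != j -> b l = 0.
  by move=> li lj; rewrite /b M2v// mem_filter lj inL.
have sum2 (f : I -> R) : (forall l, l != i -> l != j -> f l = 0) ->
    \sum_l f l = f i + f j.
  move=> f0; rewrite (bigD1 i)//= (bigD1 j)//= big1 ?addr0//.
  by move=> l /andP[]; exact: f0.
have uu : inner u u = a i ^+ 2.
  rewrite -pM1 -/a /inner sum2 ?(a0 j)// ?mulr0 ?addr0 ?expr2//.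
  by move=> l li _; rewrite a0// mulr0.
have uv : inner u v = a i * b i.
  rewrite -pM1 -pM2 M2E -/a -/b /inner sum2 ?(a0 j)// ?mul0r ?addr0//.
  by move=> l li _; rewrite a0// mul0r.
have vv : inner v v = b i ^+ 2 + b j ^+ 2.
  rewrite -pM1 -pM2 -/b /inner sum2 ?expr2//.
  by move=> l li lj; rewrite b0// mulr0.
exists (a i), (b i), (b j); split => // G mG.
have du w : dot u Z w = a i * Z2 i w.
  rewrite -dZ1 -dZ2 M2E -/a /dot sum2 ?(a0 j)// ?mul0r ?addr0//.
  by move=> l li _; rewrite a0// mul0r.
have dv w : dot v Z w = b i * Z2 i w + b j * Z2 j w.
  rewrite -dZ1 -dZ2 -/b /dot sum2//.
  by move=> l li lj; rewrite b0// mul0r.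
have := @iid_gauss_pair Z2 i j iZ2 ij (fun=> setT)
  [set z | G (a i * z.1, b i * z.1 + b j * z.2)].
rewrite big1 ?mul1e; last by move=> l _; rewrite probability_setT.
rewrite [X in X `&` _](_ : _ = setT) ?setTI; last by apply/seteqP; split.
move=> <- //.
  by congr (P _); apply/seteqP; split => w /=; rewrite du dv.
rewrite -[X in measurable X]setTI.
have : measurable_fun [set: R * R]
    (fun z : R * R => (a i * z.1, b i * z.1 + b j * z.2)).
  apply/measurable_fun_pairP; split; last exact: measurable_lin2.
  by apply: measurable_funM.
by apply.
Qed.

Lemma iid_gauss_law1 Z : iid_gauss Z -> forall v,
  exists2 al, al ^+ 2 = inner v v & forall B : set R, measurable B ->
    P [set w | B (dot v Z w)] = gauss [set x | B (al * x)].
Proof.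
move=> iZ v; case: (pickP (mem I)) => [i _|I0]; last first.
  (* Without any coordinate the linear form is identically 0, the degenerate Gaussian. *)
  exists 0; first by rewrite expr0n/= /inner big_pred0.
  move=> B mB.
  have -> : [set w | B (dot v Z w)] = [set w | B 0].
    by apply/seteqP; split => w /=; rewrite /dot big_pred0.
  have -> : [set x : R | B (0 * x)] = [set _ | B 0].
    by apply/seteqP; split => x /=; rewrite mul0r.
  have [B0|B0] := pselect (B 0).
    rewrite [X in P X](_ : _ = setT) ?[X in gauss X](_ : _ = setT) ?probability_setT//.
    - by apply/seteqP; split.
    - by apply/seteqP; split.
  rewrite [X in P X](_ : _ = set0) ?[X in gauss X](_ : _ = set0) ?measure0//.
  - by apply/seteqP; split.
  - by apply/seteqP; split.
pose L := [seq l <- enum I | l != i].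
have iL : i \notin L by rewrite mem_filter eqxx.
have [Z1 [M1 [iZ1 dZ1 pM1 M1v _]]] := iid_gauss_reduce v iZ iL.
pose a := M1 v.
have a0 l : l != i -> a l = 0.
  by move=> li; rewrite /a M1v// mem_filter li mem_enum.
exists (a i).
  rewrite -pM1 -/a /inner (bigD1 i)//= big1 ?addr0 ?expr2//.
  by move=> l li; rewrite a0// mulr0.
move=> B mB.
have dv w : dot v Z w = a i * Z1 i w.
  rewrite -dZ1 -/a /dot (bigD1 i)//= big1 ?addr0//.
  by move=> l li; rewrite a0// mul0r.
have [_ /(_ (fun l => if l == i then [set x | B (a i * x)] else setT))] := iZ1.
rewrite (bigD1 i)//= eqxx big1 ?mule1; last first.
  by move=> l /negbTE ->; rewrite probability_setT.
move=> <-.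
  congr (P _); apply/seteqP; split => w /=; last first.
    by move=> /(_ i Logic.I); rewrite /= eqxx dv.
  by rewrite dv => Bw l _ /=; case: eqVneq => // ->.
move=> l; case: ifP => // _; rewrite -[X in measurable X]setTI.
have : measurable_fun [set: R] (fun x : R => a i * x) by exact: measurable_funM.
by apply.
Qed.

End gaussian_families.

(** * The standard normal distribution function *)

Section normal_distribution_function.
Variable R : realType.
Local Notation gaussR := (@normal_prob R 0 1).
Local Notation mu := (@lebesgue_measure R).
Local Notation phi := (@normal_pdf R 0 1).
Local Notation peak := (@normal_peak R 1).
Local Notation N := (@normal_df R).

Let mphi (B : set R) : measurable_fun B (fun x => (phi x)%:E).
Proof. by apply/measurable_EFinP/measurable_funTS; exact: measurable_normal_pdf. Qed.

Let gauss_fin (B : set R) : measurable B -> gaussR B \is a fin_num.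
Proof. by move=> mB; exact: fin_num_measure. Qed.

Let lebesgue_oc (a b : R) : a <= b -> mu `]a, b] = (b - a)%:E.
Proof.
move=> ab; rewrite lebesgue_measure_itv/= lte_fin.
by case: ltP => // ba; rewrite (@le_anti _ _ a b) ?ab// subrr.
Qed.

Lemma normal_dfB (a b : R) : a <= b -> N b - N a = fine (gaussR `]a, b]).
Proof.
move=> ab; rewrite /normal_df.
have -> : `]-oo, b]%classic = `]-oo, a] `|` `]a, b]%classic :> set R.
  apply/seteqP; split => x /=; rewrite !in_itv/=.
    by have [xa|ax] := leP x a; [left|right].
  by case=> [xa|/andP[]//]; exact: le_trans ab.
rewrite measureU//=.
  by rewrite fineD ?gauss_fin// addrC addKr.
by apply/seteqP; split => x //=; rewrite !in_itv/= => -[xa /andP[]]; rewrite ltNge xa.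
Qed.

Lemma normal_df_lipschitz (a b : R) : a <= b -> N b - N a <= peak * (b - a).
Proof.
move=> ab; rewrite normal_dfB// -lee_fin fineK ?gauss_fin//.
rewrite EFinM -lebesgue_oc// -integral_cst//.
apply: ge0_le_integral => //.
- by move=> x _; rewrite lee_fin normal_pdf_ge0.
- exact: mphi.
- by move=> x _; rewrite lee_fin normal_pdf_ub ?oner_neq0.
Qed.

Lemma normal_df_lt (a b : R) : a < b -> N a < N b.
Proof.
move=> ab; rewrite -subr_gt0 normal_dfB ?ltW//.
(* On []a, b]] the density is at least its value at [M], which is positive. *)
pose M : R := Num.max `|a| `|b|.
have phiM x : `|x| <= M -> phi M <= phi x.
  move=> xM; rewrite !normal_pdfE ?oner_neq0// /normal_fun !subr0.
  rewrite ler_pM2l ?normal_peak_gt0 ?oner_neq0// ler_expR.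
  rewrite ler_pM2r ?invr_gt0 ?expr1n// lerN2.
  by rewrite -[x ^+ 2]real_normK ?num_real// lerXn2r// nnegrE// (le_trans _ xM).
have phiM0 : 0 < phi M.
  by rewrite normal_pdfE ?oner_neq0// mulr_gt0 ?expR_gt0// normal_peak_gt0 ?oner_neq0.
apply: (@lt_le_trans _ _ (phi M * (b - a))).
  by rewrite mulr_gt0// subr_gt0.
rewrite -lee_fin fineK ?gauss_fin// EFinM -lebesgue_oc ?(ltW ab)// -integral_cst//.
apply: ge0_le_integral => //.
- by move=> x _; rewrite lee_fin normal_pdf_ge0.
- exact: mphi.
- move=> x /=; rewrite in_itv/= => /andP[ax xb]; rewrite lee_fin phiM// /M.
  have [x0|x0] := leP 0 x.
    by rewrite ger0_norm// le_max (le_trans xb (ler_norm _)) orbT.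
  by rewrite ltr0_norm// le_max -normrN (le_trans _ (ler_norm _))// lerN2 ltW.
Qed.

(** A half-turn of the plane negates the first coordinate; it is applied to a set that leaves the
    second one free. *)
Lemma gauss_opp (B : set R) : measurable B -> gaussR [set x | B (- x)] = gaussR B.
Proof.
move=> mB; have mBT : measurable (B `*` [set: R]) by exact: measurableX.
have N1 : (-1) ^+ 2 + 0 ^+ 2 = 1 :> R by rewrite sqrrN expr1n expr0n addr0.
have := gauss2_rotation N1 mBT.
have -> : rotation (-1) 0 @^-1` (B `*` setT) = [set x | B (- x)] `*` [set: R].
  by apply/seteqP; split => -[x y] [/=]; rewrite !mulN1r mul0r addr0.
rewrite !product_measure1E//.
  have gT : gaussR setT = 1%E by exact: probability_setT.
  by rewrite /= !gT !mule1.
rewrite -[X in measurable X]setTI.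
by apply: (@oppr_measurable R) => //.
Qed.

Lemma p_E (t : R) : 0 <= t -> p_ t = fine (gaussR `[- t, t]).
Proof.
move=> t0.
have gt_t : fine (gaussR `]t, +oo[) = 1 - N t.
  have -> : `]t, +oo[%classic = ~` `]-oo, t] :> set R by rewrite setCitvl.
  by rewrite probability_setC// fineB ?gauss_fin.
have lt_t : gaussR `]-oo, - t[ = gaussR `]t, +oo[.
  rewrite -gauss_opp//; congr (gaussR _).
  by apply/seteqP; split => x /=; rewrite !in_itv/= andbT ltrN2.
have : gaussR setT =
    (gaussR (`]-oo, (- t)%R[ `|` `[(- t)%R, t]) + gaussR `]t, +oo[)%E.
  rewrite -measureU//.
  - congr (gaussR _); apply/seteqP; split => x //= _; rewrite !in_itv/= andbT.
    have [?|?] := ltP x (- t); first by left; left.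
    by have [?|?] := leP x t; [left; right|right].
  - exact: measurableU.
  - apply/seteqP; split => x //=; rewrite !in_itv/= andbT => -[[xt|/andP[_ xt]] tx].
      by have := lt_trans tx xt; lra.
    by have := le_lt_trans xt tx; rewrite ltxx.
rewrite measureU//; last first.
  apply/seteqP; split => x //=; rewrite !in_itv/= => -[xt /andP[tx _]].
  by have := le_lt_trans tx xt; rewrite ltxx.
have ea : gaussR `]t, +oo[ = (1 - N t)%:E by rewrite -gt_t fineK// gauss_fin.
have eb : gaussR `[- t, t] = (fine (gaussR `[- t, t]))%:E.
  by rewrite fineK// gauss_fin.
rewrite probability_setT /= lt_t ea eb -!EFinD => -[]; rewrite -eb /p_; lra.
Qed.

Lemma normal_df_0 : N 0 = 1 / 2.
Proof.
have := @p_E 0 (lexx _); rewrite oppr0 set_itv1.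
have -> : gaussR [set 0] = 0%E by rewrite /normal_prob integral_set1.
by rewrite /p_ /=; lra.
Qed.

Lemma normal_df_le1 (x : R) : N x <= 1.
Proof. by rewrite -lee_fin fineK ?gauss_fin// probability_le1. Qed.

Lemma p_gt0 (t : R) : 0 < t -> 0 < p_ t.
Proof. by move=> /normal_df_lt; rewrite normal_df_0 /p_; lra. Qed.

Lemma p_lt1 (t : R) : p_ t < 1.
Proof.
have tt1 : t < t + 1 by rewrite ltrDl.
by have := normal_df_le1 (t + 1); have := normal_df_lt tt1; rewrite /p_; lra.
Qed.

Lemma continuous_normal_df : continuous N.
Proof.
have pk0 : 0 < peak by rewrite normal_peak_gt0 ?oner_neq0.
move=> x; apply/cvgrPdist_lt => e e0.
have d0 : 0 < e / peak by rewrite divr_gt0.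
near=> y.
have xy : `|x - y| < e / peak by near: y; exact: (nbhsx_ballx x (e / peak)).
apply: (@le_lt_trans _ _ (peak * `|x - y|)); last first.
  by rewrite mulrC -ltr_pdivlMr.
have [le_xy|/ltW le_yx] := leP x y.
  rewrite distrC (distrC x) !ger0_norm ?subr_ge0//.
    exact: normal_df_lipschitz.
  by rewrite -subr_ge0 normal_dfB// fine_ge0.
rewrite !ger0_norm ?subr_ge0//; first exact: normal_df_lipschitz.
by rewrite -subr_ge0 normal_dfB// fine_ge0.
Unshelve. all: by end_near. Qed.

(** [get] returns a preimage only if one exists; the intermediate value theorem provides it, [N]
    going from 1/2 at 0 to 1 at infinity. *)
Lemma normal_df_inv_45 : N (normal_df_inv (4 / 5)) = 4 / 5.
Proof.
suff [x Nx] : exists x, N x = 4 / 5.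
  by rewrite /normal_df_inv; apply: (@getPex _ [set x | N x = 4 / 5]); exists x.
have Ncvg : N b @[b --> +oo%R] --> (1 : R).
  pose idR : measurableTypeR R -> R := idfun.
  have idm : measurable_fun setT idR by exact: measurable_id.
  pose X : {mfun measurableTypeR R >-> R} :=
    HB.pack idR (isMeasurableFun.Build _ _ _ _ idR idm).
  by have /fine_cvg := @cvg_cdfy1 _ _ _ gaussR X.
have [b [b0 Nb]] : exists b, 0 <= b /\ 4 / 5 < N b.
  near (pinfty_nbhs R) => b; exists b; split.
    by near: b; exact: nbhs_pinfty_ge.
  by near: b; apply: (cvgr_gt _ Ncvg); lra.
have [||x _ Nx] := @IVT R N 0 b (4 / 5) b0.
- by apply: continuous_subspaceT; exact: continuous_normal_df.
- by rewrite normal_df_0 ge_min le_max (ltW Nb) orbT andbT; apply/orP; left; lra.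
- by exists x.
Unshelve. all: by end_near. Qed.

Lemma normal_df_inv_45_gt0 : 0 < normal_df_inv (4 / 5) :> R.
Proof.
rewrite ltNge; apply/negP; rewrite le_eqVlt => /orP[/eqP q0|/normal_df_lt].
  by have := normal_df_inv_45; rewrite q0 normal_df_0; lra.
by rewrite normal_df_inv_45 normal_df_0; lra.
Qed.

Lemma p_inv_45 : p_ (normal_df_inv (4 / 5)) = 3 / 5 :> R.
Proof. by rewrite /p_ normal_df_inv_45; lra. Qed.

(** Since [|al| = 1] and [|be| = |rho|], the event forces [|z1| <= q] and then
    [|de z2| <= q (1 + |rho|)]. It thus lies in a rectangle whose second half-side [q'] exceeds [q]
    by at most [3 q |rho|], and [p_] is Lipschitz with constant twice the peak of the density. *)
Lemma gauss2_square_le (q al be de rho : R) : 0 < q -> `|rho| <= 1 / 2 ->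
  al ^+ 2 = 1 -> al * be = rho -> be ^+ 2 + de ^+ 2 = 1 ->
  (gaussR \x gaussR)%E
    [set z : R * R | `|al * z.1| <= q /\ `|be * z.1 + de * z.2| <= q]
  \is a fin_num /\
  fine ((gaussR \x gaussR)%E
    [set z : R * R | `|al * z.1| <= q /\ `|be * z.1 + de * z.2| <= q]) <=
  p_ q ^+ 2 + 6 * q * peak * `|rho|.
Proof.
move=> q0 rho2 al1 albe bede.
have nal : `|al| = 1.
  have : `|al| ^+ 2 = 1 by rewrite real_normK ?num_real.
  by move/eqP; rewrite sqrp_eq1// => /eqP.
have nbe : `|be| = `|rho| by rewrite -albe normrM nal mul1r.
have r0 : 0 <= `|rho| by [].
have de2 : `|de| ^+ 2 = 1 - `|rho| ^+ 2.
  by rewrite -nbe !real_normK ?num_real// -bede addrC addKr.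
have d0 : 0 <= `|de| by [].
have d1 : 1 / 2 <= `|de| by nra.
have d3 : 1 - `|rho| ^+ 2 <= `|de| by nra.
pose q' := q * (1 + `|rho|) / `|de|.
have dgt0 : 0 < `|de| by apply: lt_le_trans d1; lra.
have q'0 : 0 <= q' by rewrite /q' divr_ge0// mulr_ge0 ?(ltW q0)// addr_ge0.
set E := [set z | _].
have mE : measurable E.
  have mn (a b : R) : measurable [set z : R * R | `|a * z.1 + b * z.2| <= q].
    rewrite -[X in measurable X]setTI.
    have -> : [set z : R * R | `|a * z.1 + b * z.2| <= q] =
        (fun z : R * R => `|a * z.1 + b * z.2|) @^-1` `]-oo, q].
      by apply/seteqP; split => z /=; rewrite in_itv.
    have : measurable_fun [set: R * R] (fun z : R * R => `|a * z.1 + b * z.2|).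
      by apply: measurableT_comp => //; exact: measurable_lin2.
    by apply.
  have -> : E = [set z : R * R | `|al * z.1 + 0 * z.2| <= q] `&`
      [set z : R * R | `|be * z.1 + de * z.2| <= q].
    by apply/seteqP; split => z; rewrite /E /= mul0r addr0.
  exact: measurableI.
have sE : E `<=` `[- q, q] `*` `[- q', q'].
  move=> [x y] [/=]; rewrite normrM nal mul1r => xq.
  move=> byq; rewrite !in_itv/= -!ler_norml; split => //.
  rewrite /q' ler_pdivlMr// mulrC -normrM.
  have -> : de * y = (be * x + de * y) - be * x by ring.
  apply: (le_trans (ler_normB _ _)); rewrite normrM nbe mulrDr mulr1.
  by rewrite lerD// mulrC ler_wpM2r.
have mQ : measurable (`[- q, q] `*` `[- q', q'] : set (R * R)).
  exact: measurableX.
have gQ : (gaussR \x gaussR)%E (`[- q, q] `*` `[- q', q'] : set (R * R)) =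
    (p_ q * p_ q')%:E.
  by rewrite product_measure1E// !p_E// ?(ltW q0)// EFinM !fineK ?gauss_fin.
have le_E : ((gaussR \x gaussR)%E E <= (p_ q * p_ q')%:E)%E.
  by rewrite -gQ; apply: le_measure; rewrite ?inE.
have fE : (gaussR \x gaussR)%E E \is a fin_num.
  by rewrite ge0_fin_numE// (le_lt_trans le_E)// ltry.
split => //.
rewrite -lee_fin fineK//; apply: (le_trans le_E); rewrite lee_fin.
(* Writing [r] for [|rho|]: [|de| >= 1/2] and [|de| >= 1 - r^2] give
   [(3 r + 1) |de| >= 3 r / 2 + 1 - r^2], which is at least [1 + r] because [r <= 1/2]. *)
have qq' : q' - q <= 3 * q * `|rho|.
  rewrite lerBlDr /q' ler_pdivrMr//.
  have h1 : 0 <= `|rho| * (`|de| - 1 / 2) by rewrite mulr_ge0// subr_ge0.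
  have h2 : 0 <= `|rho| * (1 / 2 - `|rho|) by rewrite mulr_ge0// subr_ge0.
  have -> : 3 * q * `|rho| + q = q * (3 * `|rho| + 1) by ring.
  by rewrite -mulrA ler_pM2l//; nra.
have q_q' : q <= q'.
  rewrite /q' ler_pdivlMr// ler_pM2l//; nra.
have := normal_df_lipschitz q_q'.
have pk : 0 <= peak by exact: normal_peak_ge0.
have : peak * (q' - q) <= peak * (3 * q * `|rho|) by rewrite ler_wpM2l.
have pq1 := p_lt1 q.
have pq0 := p_gt0 q0.
move=> H1 H2.
have H3 : p_ q' - p_ q <= 6 * q * peak * `|rho| by rewrite /p_; nra.
have k0 : 0 <= 6 * q * peak * `|rho| by rewrite !mulr_ge0// ltW.
nra.
Qed.

End normal_distribution_function.

(** * Gaussian vectors with a given covariance *)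

Section gaussian_law.
Context d (T : measurableType d) (R : realType) (P : probability T R).
Local Notation gaussR := (@normal_prob R 0 1).
Variables (Y : T -> R) (al : R).
Hypothesis mY : measurable_fun [set: T] Y.
Hypothesis lawY : forall B : set R, measurable B ->
  P [set w | B (Y w)] = gaussR [set x | B (al * x)].

Let mal : measurable_fun [set: measurableTypeR R]
  (fun x : measurableTypeR R => al * x : R).
Proof. exact: measurable_funM. Qed.

Let lawY_integral (g : R -> \bar R) : measurable_fun [set: R] g ->
  (forall x, 0 <= g x)%E ->
  (\int[P]_w g (Y w) = \int[gaussR]_x g (al * x)%R)%E.
Proof.
move=> mg g0.
have := ge0_integral_pushforward mY P measurableT mg (fun y _ => g0 y).
rewrite preimage_setT => <-.
have := ge0_integral_pushforward mal gaussR measurableT mg (fun y _ => g0 y).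
rewrite preimage_setT => <-.
by apply: eq_measure_integral => B mB _; exact: lawY.
Qed.

Let integral_sqr : (\int[P]_w (Y w ^+ 2)%:E = (al ^+ 2)%:E)%E.
Proof.
rewrite (lawY_integral (g := fun x => (x ^+ 2)%:E)); last 2 first.
- by apply/measurable_EFinP; exact: measurable_funX.
- by move=> x; rewrite lee_fin sqr_ge0.
under eq_integral do rewrite exprMn EFinM.
rewrite ge0_integralZl//.
- by rewrite integral_gauss_sqr mule1.
- by apply/measurable_EFinP; exact: measurable_funX.
- by move=> x _; rewrite lee_fin sqr_ge0.
- by rewrite lee_fin sqr_ge0.
Qed.

Lemma gauss_law_Lfun2 : Y \in Lfun P 2%:E.
Proof.
rewrite inE; apply/andP; split; rewrite inE//=.
rewrite /finite_norm unlock/=; apply: poweR_lty.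
under eq_integral do rewrite powR_mulrn// real_normK ?num_real//.
by rewrite integral_sqr ltry.
Qed.

(** [Y] and [- Y] have the same law, so the positive and negative parts of [Y] have equal integrals;
    square integrability makes these finite, so that they cancel. *)
Let mean0 : (forall B : set R, measurable B ->
    P [set w | B (- Y w)] = gaussR [set x | B (al * x)]) ->
  'E_P[Y]%E = 0%E.
Proof.
move=> lawNY.
have iY : P.-integrable [set: T] (EFin \o Y).
  apply/Lfun1_integrable; apply: Lfun_subset12; first exact: fin_num_measure.
  exact: gauss_law_Lfun2.
rewrite unlock integralE.
have := integrable_pos_fin_num measurableT iY.
pose g (x : R) : \bar R := maxe x%:E 0.
have mg : measurable_fun [set: R] g by apply: measurable_maxe.
have g0 x : (0 <= g x)%E by rewrite le_max lexx orbT.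
have -> : (\int[P]_x (EFin \o Y)^\- x = \int[P]_x (EFin \o Y)^\+ x)%E.
  transitivity (\int[P]_w g (- Y w)%R)%E.
    by apply: eq_integral => w _; rewrite funenegE.
  transitivity (\int[P]_w g (Y w))%E; last first.
    by apply: eq_integral => w _; rewrite funeposE.
  rewrite lawY_integral//.
  have mNY : measurable_fun [set: T] (fun w => - Y w) by exact: measurableT_comp.
  have := ge0_integral_pushforward mNY P measurableT mg (fun y _ => g0 y).
  rewrite preimage_setT => <-.
  have := ge0_integral_pushforward mal gaussR measurableT mg (fun y _ => g0 y).
  rewrite preimage_setT => <-.
  by apply: eq_measure_integral => B mB _; exact: lawNY.
by move=> fin; rewrite subee.
Qed.

Lemma gauss_law_variance : 'V_P[Y]%E = (al ^+ 2)%:E.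
Proof.
have E0 : 'E_P[Y]%E = 0%E.
  apply: mean0 => B mB.
  rewrite (lawY (B := [set x | B (- x)])); last first.
    by rewrite -[X in measurable X]setTI; exact: (@oppr_measurable R).
  have mB' : measurable [set x | B (al * x)].
    by rewrite -[X in measurable X]setTI; exact: mal.
  rewrite -(gauss_opp mB').
  by congr (gaussR _); apply/seteqP; split => x /=; rewrite mulrN.
rewrite varianceE; last exact: gauss_law_Lfun2.
by rewrite E0 expe2 mule0 sube0 unlock integral_sqr.
Qed.

End gaussian_law.

Lemma iid_standard_normal_gauss d (T : measurableType d) (R : realType)
    (P : probability T R) (V : choiceType) (D : set V) (Y : V -> {mfun T >-> R})
    (I : finType) (f : I -> V) :
  iid_standard_normal P D Y -> injective f -> (forall i, D (f i)) ->
  iid_gauss P (fun i => Y (f i) : T -> R).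
Proof.
move=> [nY iY] fI Df; split => // B mB.
pose J : {fset V} := [fset x in [seq f i | i <- enum I]]%fset.
have inJ v : (v \in J) = (v \in [seq f i | i <- enum I]) by rewrite !inE.
(* The sets are carried from indices to elements of [V]; injectivity of [f] makes the pick recover
   the index. *)
pose B' v := if [pick i | f i == v] is Some i then B i else setT.
have B'f i : B' (f i) = B i.
  rewrite /B'; case: pickP => [j /eqP/fI -> //|/(_ i)].
  by rewrite eqxx.
have := iY J B'.
rewrite (perm_big [seq f i | i <- enum I]); last first.
  by apply: uniq_perm => //; rewrite map_inj_uniq// enum_uniq.
rewrite big_map big_enum/=.
under eq_bigr => i _ do rewrite B'f.
move=> H; transitivity (\prod_i P (Y (f i) @^-1` B i))%E; last first.
  by apply: eq_bigr => i _; exact: (nY _ (Df i) _ (mB i)).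
rewrite -H.
- congr (P _); apply/seteqP; split => w.
    move=> Hw v /=; rewrite inJ => /mapP[i _ ->]; rewrite B'f.
    exact: (Hw i).
  move=> Hw i _; have := Hw (f i); rewrite /= inJ B'f; apply.
  by apply: map_f; rewrite mem_enum.
- by move=> v; rewrite inJ => /mapP[i _ ->].
- by move=> v; rewrite /B'; case: pickP.
Qed.

Section gaussian_vector.
Context d (T : measurableType d) (R : realType) (P : probability T R) (n : nat).
Variables (Y : 'I_n -> {mfun T >-> R}) (K : 'I_n -> 'I_n -> R).
Local Notation gaussR := (@normal_prob R 0 1).
Local Notation gauss2 := (gaussR \x gaussR)%E.

Definition lincomb (u : 'I_n -> R) (w : T) : R := \sum_i u i * Y i w.

(** With [K] the covariance matrix of [Y], this is the covariance of [lincomb u] and [lincomb v]. *)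
Definition quad (u v : 'I_n -> R) : R := \sum_i \sum_j u i * v j * K i j.

Lemma measurable_lincomb u : measurable_fun [set: T] (lincomb u).
Proof. by apply: measurable_sum => i; exact: measurable_funM. Qed.

Hypothesis gaussY : centered_gaussian_vector P Y.
Hypothesis covY : forall i j, covariance P (Y i) (Y j) = (K i j)%:E.

(** The point is that [A] times its transpose equals [K], although the definition of a Gaussian
    vector says nothing about [A]. It follows from the variances of the linear forms, computed on
    the side of [Z]. *)
Let representation : exists (m : nat) (A : 'M[R]_(n, m)) d' (T' : measurableType d')
    (P' : probability T' R) (Z : 'I_m -> T' -> R),
  let comb u j := \sum_i u i * A i j in
  [/\ iid_gauss P' Z,
    (forall u v, inner (comb u) (comb v) = quad u v) &
    forall u v (G : set (R * R)), measurable G ->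
      P [set w | G (lincomb u w, lincomb v w)] =
      P' [set w | G (dot (comb u) Z w, dot (comb v) Z w)]].
Proof.
have [m [A [d' [T' [P' [Z [iZ lawYZ]]]]]]] := gaussY.
have iZ' : iid_gauss P' (fun i => Z i : T' -> R).
  exact: (@iid_standard_normal_gauss _ _ _ _ _ _ _ _ id iZ).
exists m, A, d', T', P', (fun i => Z i : T' -> R) => comb.
have dotE u w : dot (comb u) (fun i => Z i : T' -> R) w =
    \sum_i u i * \sum_j A i j * Z j w.
  rewrite /dot /comb; under eq_bigr do rewrite mulr_suml.
  rewrite exchange_big/=; apply: eq_bigr => i _.
  by rewrite mulr_sumr; apply: eq_bigr => j _; rewrite mulrA.
have law2 u v (G : set (R * R)) : measurable G ->
      P [set w | G (lincomb u w, lincomb v w)] =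
      P' [set w | G (dot (comb u) (fun i => Z i : T' -> R) w,
                     dot (comb v) (fun i => Z i : T' -> R) w)].
  move=> mG.
  (* Laws are only compared on the product space, so the event is first written as the preimage of a
     measurable set there. *)
  pose lin (u : 'I_n -> R) (x : product_space R 'I_n) :=
    \sum_i u i * (x : 'I_n -> R) i.
  have mlin u' : measurable_fun [set: product_space R 'I_n] (lin u').
    apply: measurable_sum => i; apply: measurable_funM => //.
    exact: measurable_coordinate.
  have mB : measurable [set x : product_space R 'I_n | G (lin u x, lin v x)].
    rewrite -[X in measurable X]setTI.
    have : measurable_fun [set: product_space R 'I_n] (fun x => (lin u x, lin v x)).
      by apply/measurable_fun_pairP; split; exact: mlin.
    by apply.
  rewrite [LHS](lawYZ _ mB); congr (P' _).
  by apply/seteqP; split => w /=; rewrite !dotE.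
have law1 u : exists2 al, al ^+ 2 = inner (comb u) (comb u) &
    forall B : set R, measurable B ->
    P [set w | B (lincomb u w)] = gaussR [set x | B (al * x)].
  have [al al2 H] := iid_gauss_law1 iZ' (comb u).
  exists al => // B mB; rewrite -H//.
  have mBT : measurable (B `*` [set: R]) by exact: measurableX.
  have := law2 u u _ mBT.
  rewrite (_ : [set w | (B `*` [set: R]) (lincomb u w, lincomb u w)] =
    [set w | B (lincomb u w)]); last by apply/seteqP; split => w //= [].
  by move=> ->; congr (P' _); apply/seteqP; split => w //= [].
have varE u : 'V_P[lincomb u]%E = (inner (comb u) (comb u))%:E.
  have [al <- H] := law1 u.
  by apply: gauss_law_variance => //; exact: measurable_lincomb.
have L2 u : lincomb u \in Lfun P 2%:E.
  have [al _ H] := law1 u.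
  by apply: (gauss_law_Lfun2 _ H); exact: measurable_lincomb.
pose e i (j : 'I_n) : R := (j == i)%:R.
have lincomb_e i : lincomb (e i) = Y i.
  apply/funext => w; rewrite /lincomb /e (bigD1 i)//= eqxx mul1r big1 ?addr0//.
  by move=> j /negbTE ->; rewrite mul0r.
have lincombD u v : lincomb (u \+ v) = (lincomb u \+ lincomb v)%R.
  apply/funext => w; rewrite /lincomb/= -big_split/=.
  by apply: eq_bigr => j _; rewrite mulrDl.
have combD u v : comb (u \+ v) = (comb u \+ comb v)%R.
  apply/funext => w; rewrite /comb/= -big_split/=.
  by apply: eq_bigr => j _; rewrite mulrDl.
have comb_e i : comb (e i) = fun j => A i j.
  apply/funext => j; rewrite /comb /e (bigD1 i)//= eqxx mul1r big1 ?addr0//.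
  by move=> l /negbTE ->; rewrite mul0r.
have innerDD (u v : 'I_m -> R) : inner (u \+ v) (u \+ v) =
    inner u u + inner v v + 2 * inner u v.
  rewrite /inner mulr_sumr -!big_split/=; apply: eq_bigr => i _; ring.
(* Polarisation: the variance of [Y i + Y j] is computed once from the covariances and once from the
   rows of [A]. *)
have gram i j : inner (fun k => A i k) (fun k => A j k) = K i j.
  have := varianceD (L2 (e i)) (L2 (e j)).
  rewrite -lincombD !varE combD innerDD !lincomb_e covY -EFinM -!EFinD !comb_e.
  by move=> [] /addrI /mulfI; apply; rewrite pnatr_eq0.
split => // u v.
rewrite /inner /quad /comb.
under eq_bigr => k _ do rewrite big_distrlr/=.
rewrite exchange_big/=; apply: eq_bigr => i _.
rewrite exchange_big/=; apply: eq_bigr => j _.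
rewrite -gram /inner mulr_sumr; apply: eq_bigr => k _; ring.
Qed.

Lemma gaussian_vector_law1 u : exists2 al, al ^+ 2 = quad u u &
  forall B : set R, measurable B ->
    P [set w | B (lincomb u w)] = gaussR [set x | B (al * x)].
Proof.
have [m [A [d' [T' [P' [Z [iZ gram law]]]]]]] := representation.
have [al al2 H] := iid_gauss_law1 iZ (fun j => \sum_i u i * A i j).
exists al; first by rewrite -gram.
move=> B mB; rewrite -H//.
have mBT : measurable (B `*` [set: R]) by exact: measurableX.
have := law u u _ mBT.
rewrite (_ : [set w | (B `*` [set: R]) (lincomb u w, lincomb u w)] =
  [set w | B (lincomb u w)]); last by apply/seteqP; split => w //= [].
by move=> ->; congr (P' _); apply/seteqP; split => w //= [].
Qed.

Lemma gaussian_vector_law2 u v : quad u v ^+ 2 < quad u u * quad v v ->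
  exists al be de, [/\ al ^+ 2 = quad u u, al * be = quad u v,
    be ^+ 2 + de ^+ 2 = quad v v &
    forall G : set (R * R), measurable G ->
      P [set w | G (lincomb u w, lincomb v w)] =
      gauss2 [set z | G (al * z.1, be * z.1 + de * z.2)]].
Proof.
have [m [A [d' [T' [P' [Z [iZ gram law]]]]]]] := representation.
rewrite -!gram.
(* The strict Cauchy-Schwarz inequality rules out m <= 1. *)
case: m A Z iZ gram law => [|[|m]] A Z iZ gram law CS.
- by move: CS; rewrite /inner !big_ord0 mul0r expr0n ltxx.
- by move: CS; rewrite /inner !big_ord1 exprMn -!expr2 ltxx.
have ij : (ord0 : 'I_m.+2) != lift ord0 ord0 by [].
have [al [be [de [aa ab bb H]]]] := iid_gauss_law2 iZ ij
  (fun j => \sum_i u i * A i j) (fun j => \sum_i v i * A i j).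
exists al, be, de; split => // G mG.
by rewrite -H// law.
Qed.

End gaussian_vector.

(** * Concentration of the number of successes *)

Lemma prod_1D (R : comNzRingType) (I : finType) (Q : {set I}) (y : I -> R) :
  \prod_(i in Q) (1 + y i) = \sum_(A : {set I} | A \subset Q) \prod_(i in A) y i.
Proof.
transitivity (\prod_i ((if i \in Q then y i else 0) + 1)).
  rewrite big_mkcond/=; apply: eq_bigr => i _.
  by case: ifP => _; rewrite ?add0r// addrC.
rewrite bigA_distr [RHS]big_mkcond/=; apply: eq_bigr => A _.
rewrite -big_mkcond/=; case: ifPn => [AQ|/fintype.subsetPn[i iA iQ]].
  by apply: eq_bigr => i iA; rewrite (fintype.subsetP AQ).
by rewrite (bigD1 i)//= (negbTE iQ) mul0r.
Qed.

Lemma prod_indic (R : realType) (T : Type) (I : finType) (A : {set I})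
    (D : I -> set T) w :
  \prod_(i in A) \1_(D i) w = \1_(\bigcap_(i in [set` A]) D i) w :> R.
Proof.
rewrite [RHS]indicE; have [/set_mem Dw|Dw] := boolP (w \in _).
  by rewrite big1// => i iA; rewrite indicE mem_set//; exact: Dw.
have [i iA Dwi] : exists2 i, i \in A & ~ D i w.
  apply: contrapT => H; move/negP: Dw; apply; rewrite inE => i iA.
  by apply: contrapT => Dwi; apply: H; exists i.
by rewrite (bigD1 i)//= indicE memNset// mul0r.
Qed.

Lemma sum_indicE (R : realType) (T : Type) (I : finType) (Q : {set I})
    (D : I -> set T) w :
  (\sum_(i in Q) (w \in D i))%N%:R = \sum_(i in Q) \1_(D i) w :> R.
Proof. by rewrite natr_sum; apply: eq_bigr => i _; rewrite indicE. Qed.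

Section concentration.
Context d (T : measurableType d) (R : realType) (P : probability T R).
Context (I : finType) (D : I -> set T) (Q : {set I}).
Hypothesis mD : forall i, measurable (D i).

Lemma measurable_count_le (x : R) :
  measurable [set w | (\sum_(i in Q) (w \in D i))%N%:R <= x].
Proof.
under eq_set do rewrite sum_indicE.
have m : measurable_fun [set: T] (fun w => \sum_(i in Q) \1_(D i) w : R).
  under eq_fun do rewrite -big_enum/=.
  by apply: measurable_sum => i; exact: measurable_indic.
rewrite -[X in measurable X]setTI (_ : mkset _ =
  (fun w => \sum_(i in Q) \1_(D i) w : R) @^-1` `]-oo, x]).
  exact: m.
by apply/seteqP; split => w /=; rewrite in_itv.
Qed.

Lemma measurable_count_gt (x : R) :
  measurable [set w | x < (\sum_(i in Q) (w \in D i))%N%:R].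
Proof.
rewrite (_ : mkset _ = ~` [set w | (\sum_(i in Q) (w \in D i))%N%:R <= x]).
  by apply: measurableC; exact: measurable_count_le.
by apply/seteqP; split => w /=; rewrite ltNge => /negP.
Qed.

(* Exponential Markov inequality at z = 1/(2p), the expectation of
   z ^ (number of events) being expanded over the subsets of Q. *)
Lemma chernoff_count (k : nat) (p : R) : 0 < p -> 2 * p <= 1 -> (#|Q| + #|Q| <= k)%N ->
  (forall A : {set I}, A \subset Q ->
    P (\bigcap_(i in [set` A]) D i) = (p ^+ #|A|)%:E) ->
  fine (P [set w | (k%:R / 4 : R) < (\sum_(i in Q) (w \in D i))%N%:R]) <=
  expR (- (k%:R / 4 * h (2 * p))).
Proof.
move=> p0 p1 Qk PA; set B := [set w | _].
have p20 : 0 < 2 * p by rewrite mulr_gt0.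
pose z := (2 * p)^-1.
have z1 : 1 <= z by rewrite invf_ge1.
have z0 : 0 < z by rewrite invr_gt0.
pose c (A : {set I}) := if A \subset Q then (z - 1) ^+ #|A| else 0.
have prodE (y : I -> R) (f : {set I} -> R) :
    (forall A : {set I}, A \subset Q -> \prod_(i in A) y i = f A) ->
    \prod_(i in Q) (1 + (z - 1) * y i) = \sum_A c A * f A.
  move=> yf; rewrite prod_1D big_mkcond/=; apply: eq_bigr => A _; rewrite /c.
  case: ifPn => AQ; last by rewrite mul0r.
  by rewrite big_split/= yf// prodr_const.
have H : expR (k%:R / 4 * ln z) * fine (P B) <=
    \sum_A c A * fine (P (\bigcap_(i in [set` A]) D i)).
  apply: weighted_union_bound.
  - exact: measurable_count_gt.
  - by move=> A; apply: fin_bigcap_measurable => // i _; exact: mD.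
  move=> w; rewrite -(prodE (fun i => \1_(D i) w)); last first.
    by move=> A _; rewrite prod_indic.
  have zw : \prod_(i in Q) (1 + (z - 1) * \1_(D i) w) =
      expR ((\sum_(i in Q) (w \in D i))%N%:R * ln z).
    rewrite sum_indicE mulr_suml expR_sum; apply: eq_bigr => i _.
    rewrite indicE; case: (w \in D i).
      by rewrite mulr1 mul1r lnK ?posrE// addrC subrK.
    by rewrite mulr0 mul0r expR0 addr0.
  rewrite zw indicE; have [/set_mem|_] := boolP (w \in B); last by rewrite mulr0 expR_ge0.
  rewrite /B/= mulr1 ler_expR => /ltW; apply: ler_wpM2r.
  by rewrite ln_ge0.
(* By independence the sum refolds into a product of at most [k / 2] factors
   [1 + (z - 1) p = 1 + (1/2 - p)], each at most [expR (1/2 - p)]. Dividing by [z] to the power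
   [k / 4] yields exactly the exponent [- (k/4) h (2 p)]. *)
have HR : \sum_A c A * fine (P (\bigcap_(i in [set` A]) D i)) <=
    expR ((1 / 2 - p) * (k%:R / 2)).
  have -> : \sum_A c A * fine (P (\bigcap_(i in [set` A]) D i)) =
      \prod_(i in Q) (1 + (z - 1) * p).
    rewrite (prodE (fun=> p) (fun A => p ^+ #|A|)); last first.
      by move=> A _; rewrite prodr_const.
    apply: eq_bigr => A _; rewrite /c; case: ifPn => AQ; last by rewrite !mul0r.
    by rewrite PA.
  have zp : (z - 1) * p = 1 / 2 - p by rewrite /z; field; rewrite gt_eqF.
  rewrite prodr_const zp.
  apply: (@le_trans _ _ (expR (1 / 2 - p) ^+ #|Q|)).
    by rewrite lerXn2r ?nnegrE ?expR_ge0 ?expR_ge1Dx//; lra.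
  rewrite -expRM_natl ler_expR mulrC ler_wpM2l//; first lra.
  have : (#|Q| + #|Q|)%:R <= k%:R :> R by rewrite ler_nat.
  by rewrite natrD; lra.
have := le_trans H HR.
rewrite -ler_pdivlMl ?expR_gt0// -expRN -expRD => /le_trans; apply.
by rewrite ler_expR /h /z lnV ?posrE// le_eqVlt; apply/orP; left; apply/eqP; field.
Qed.

(** With [x] the count and [m] its mean, [(m - a)^2] times the indicator of [x <= a] is at most
    [(m - x)^2]. Only upper bounds on the joint probabilities are needed; [e] also accounts for the
    diagonal. *)
Lemma chebyshev_count (p a : R) (e : I -> I -> R) :
  a < #|Q|%:R * p ->
  (forall i, i \in Q -> P (D i) = p%:E) ->
  (forall i j, i \in Q -> j \in Q -> fine (P (D i `&` D j)) <= p ^+ 2 + e i j) ->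
  fine (P [set w | (\sum_(i in Q) (w \in D i))%N%:R <= a :> R]) <=
  (\sum_(i in Q) \sum_(j in Q) e i j) / (#|Q|%:R * p - a) ^+ 2.
Proof.
move=> ap Pp Pe; set m := #|Q|%:R * p in ap *; set B := [set w | _].
have ma0 : 0 < m - a by rewrite subr_gt0.
rewrite ler_pdivlMr ?exprn_gt0// mulrC.
(* The three kinds of events are the terms of [x^2 - 2 m x + m^2]: pairs, single events and the
   whole space. *)
pose s : seq (I * I + (I + unit)) :=
  [seq inl (i, j) | i <- enum Q, j <- enum Q] ++
  ([seq inr (inl i) | i <- enum Q] ++ [:: inr (inr tt)]).
pose c (x : I * I + (I + unit)) : R :=
  match x with inl _ => 1 | inr (inl _) => - (2 * m) | inr (inr _) => m ^+ 2 end.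
pose E (x : I * I + (I + unit)) : set T :=
  match x with inl ij => D ij.1 `&` D ij.2 | inr (inl i) => D i
  | inr (inr _) => setT end.
have sumE (f : set T -> R) : \sum_(x <- s) c x * f (E x) =
    \sum_(i in Q) \sum_(j in Q) f (D i `&` D j)
    - 2 * m * \sum_(i in Q) f (D i) + m ^+ 2 * f setT.
  rewrite /s big_cat big_allpairs_dep big_cat big_map big_seq1 /= addrA.
  congr (_ + _ + _).
    rewrite big_enum/=; apply: eq_bigr => i _; rewrite big_enum/=.
    by apply: eq_bigr => j _; rewrite mul1r.
  by rewrite big_enum/= -[RHS]mulNr mulr_sumr.
have : (m - a) ^+ 2 * fine (P B) <= \sum_(x <- s) c x * fine (P (E x)).
  apply: weighted_union_bound.
  - exact: measurable_count_le.
  - by move=> [ij|[i|_]] /=; [apply: measurableI; exact: mD|exact: mD|exact: measurableT].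
  move=> w; rewrite (sumE (fun A => \1_A w)).
  set x := \sum_(i in Q) \1_(D i) w.
  have -> : \sum_(i in Q) \sum_(j in Q) \1_(D i `&` D j) w = x ^+ 2 :> R.
    rewrite expr2 /x mulr_suml; apply: eq_bigr => i _; rewrite mulr_sumr.
    by apply: eq_bigr => j _; rewrite indicI.
  rewrite indicT mulr1.
  have -> : x ^+ 2 - 2 * m * x + m ^+ 2 = (m - x) ^+ 2 by ring.
  rewrite indicE; have [/set_mem|_] := boolP (w \in B); last by rewrite mulr0 sqr_ge0.
  rewrite /B /= sum_indicE -/x => xa; rewrite mulr1.
  by rewrite lerXn2r ?nnegrE ?subr_ge0 ?(ltW ap) ?(le_trans xa (ltW ap))// lerD2l lerN2.
rewrite (sumE (fun A => fine (P A))) => /le_trans; apply.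
have -> : \sum_(i in Q) fine (P (D i)) = m.
  rewrite (eq_bigr (fun=> p)) => [|i iQ]; last by rewrite Pp.
  by rewrite sumr_const -mulr_natl.
rewrite probability_setT /=.
have : \sum_(i in Q) \sum_(j in Q) fine (P (D i `&` D j)) <=
    \sum_(i in Q) \sum_(j in Q) (p ^+ 2 + e i j).
  by apply: ler_sum => i iQ; apply: ler_sum => j jQ; exact: Pe.
have -> : \sum_(i in Q) \sum_(j in Q) (p ^+ 2 + e i j) =
    m ^+ 2 + \sum_(i in Q) \sum_(j in Q) e i j.
  under eq_bigr do rewrite big_split/= sumr_const.
  rewrite big_split/= sumr_const; congr (_ + _).
  by rewrite /m -[in LHS]mulr_natl -[in LHS]mulr_natl; ring.
by rewrite expr2; lra.
Qed.

End concentration.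

Section disjoint_pairs.
Context d (T : measurableType d) (R : realType) (P : probability T R).
Context (I : finType) (Z : I -> T -> R) (g : I -> I).
Hypothesis iZ : iid_gauss P Z.

(** Each eighth of a turn stores the normalised difference of a pair at its index in [L]. The last
    clause carries the induction: the next pair, disjoint from the previous ones, still holds its
    original variables. *)
Let rotate_pairs (L : seq I) : uniq L -> {in L &, injective g} ->
  (forall j, j \in L -> g j \notin L) ->
  exists Z', [/\ iid_gauss P Z',
    (forall j, j \in L -> forall w, Z' j w = (Z j w - Z (g j) w) / Num.sqrt 2) &
    (forall l, l \notin L -> (forall j, j \in L -> l != g j) -> Z' l = Z l)].
Proof.
elim: L => [|j L IH]; first by exists Z; split.
move=> /= /andP[jL uL] gI gL.
have [|i l|Z' [iZ' Z'L Z'E]] := IH uL.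
- by move=> i l iL lL; apply: gI; rewrite inE ?iL ?lL orbT.
- by have := gL i; rewrite !inE l orbT negb_or => /(_ isT) /andP[].
have jg : g j != j by have := gL j; rewrite !inE eqxx negb_or => /(_ isT) /andP[].
pose r : R := (Num.sqrt 2)^-1.
have rr : r ^+ 2 + r ^+ 2 = 1 by rewrite exprVn sqr_sqrtr//; lra.
exists (rotate_family (g j) j r r Z'); split.
- exact: iid_gauss_rotate.
- move=> i; rewrite inE => /orP[/eqP -> w|iL w].
    rewrite /rotate_family eq_sym (negbTE jg) eqxx !Z'E ?mulrBl 1?mulrC//.
    + by rewrite [r * _]mulrC.
    + by have := gL j; rewrite !inE eqxx negb_or => /(_ isT) /andP[].
    + move=> l lL; apply: contraNneq jL => /gI ->//; first by rewrite inE eqxx.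
      by rewrite inE lL orbT.
    + move=> l lL; apply: contraTneq (gL l _); last by rewrite inE lL orbT.
      by move=> <-; rewrite negbK inE eqxx.
  rewrite /rotate_family.
  have /negbTE -> : i != g j.
    apply: contraTneq (gL j _); last by rewrite inE eqxx.
    by move=> <-; rewrite negbK inE iL orbT.
  have /negbTE -> : i != j by apply: contraNneq jL => <-.
  exact: Z'L.
- move=> l; rewrite inE negb_or => /andP[lj lL] lg.
  have lgj : l != g j by apply: lg; rewrite inE eqxx.
  apply/funext => w; rewrite /rotate_family (negbTE lgj) (negbTE lj) Z'E//.
  by move=> i iL; apply: lg; rewrite inE iL orbT.
Qed.

Lemma iid_gauss_pairs (A : {set I}) (t : R) : 0 <= t ->
  {in A &, injective g} -> (forall j, j \in A -> g j \notin A) ->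
  P (\bigcap_(j in [set` A]) [set w | `|Z j w - Z (g j) w| <= Num.sqrt 2 * t]) =
  (p_ t ^+ #|A|)%:E.
Proof.
move=> t0 gI gA.
have [||Z' [[_ iZ'] Z'A _]] := @rotate_pairs (enum A) (enum_uniq _).
- by move=> i j; rewrite !mem_enum; exact: gI.
- by move=> j; rewrite !mem_enum; exact: gA.
pose B j : set R := if j \in A then `[- t, t]%classic else setT.
have s20 : 0 < Num.sqrt 2 :> R by rewrite sqrtr_gt0.
have -> : \bigcap_(j in [set` A])
    [set w | `|Z j w - Z (g j) w| <= Num.sqrt 2 * t] =
    \bigcap_(j in [set: I]) Z' j @^-1` B j.
  have E j w : j \in A ->
      (Z' j w \in `[- t, t]) = (`|Z j w - Z (g j) w| <= Num.sqrt 2 * t).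
    move=> jA; rewrite Z'A ?mem_enum// in_itv/= -ler_norml.
    by rewrite normrM normfV (ger0_norm (ltW s20)) ler_pdivrMr// mulrC.
  apply/seteqP; split => w Hw j.
    by move=> _; rewrite /B /=; case: ifP => // jA; rewrite /= E//; exact: Hw.
  by move=> /= jA; have := Hw j Logic.I; rewrite /B /= jA /= E.
rewrite iZ'; last by move=> j; rewrite /B; case: ifP.
rewrite (eq_bigr (fun j => (if j \in A then p_ t else 1)%:E)) => [|j _].
  by rewrite prodEFin -big_mkcond/= prodr_const.
rewrite /B; case: ifP => _; last by rewrite probability_setT.
by rewrite p_E// fineK// fin_num_measure.
Qed.

Lemma card_disjoint_pairs (A : {set I}) :
  {in A &, injective g} -> (forall j, j \in A -> g j \notin A) ->
  (#|A| + #|A| <= #|I|)%N.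
Proof.
move=> gI gA; rewrite -{2}(card_in_imset gI).
have -> : (#|A| + #|g @: A| = #|A :|: g @: A|)%N.
  rewrite cardsU (_ : A :&: g @: A = finset.set0) ?cards0 ?subn0//.
  apply/finset.setP => j; rewrite !inE; apply/negbTE/negP => /andP[jA /imsetP[i iA ji]].
  by have := gA i iA; rewrite -ji jA.
exact: max_card.
Qed.

End disjoint_pairs.

(** * Increments along a path *)

Section path_indices.
Variable k : nat.

(** An increment is indexed by its later end. The truncated predecessor sends 0 to itself, a value
    that [steps] keeps out. *)
Definition prev (j : 'I_k) : 'I_k :=
  Ordinal (leq_ltn_trans (leq_pred j) (ltn_ord j)).

Definition steps : {set 'I_k} := [set j : 'I_k | (0 < j)%N]%SET.

Definition parity_steps (b : bool) : {set 'I_k} :=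
  [set j : 'I_k | (0 < j)%N && (odd j == b)]%SET.

Lemma prev_inj_parity_steps b : {in parity_steps b &, injective prev}.
Proof.
move=> i j; rewrite !inE => /andP[i0 _] /andP[j0 _] [] ij; apply: val_inj.
by rewrite /= -(prednK i0) ij prednK.
Qed.

Lemma prev_parity_steps b j : j \in parity_steps b -> prev j \notin parity_steps b.
Proof.
rewrite !inE => /andP[j0 /eqP jb]; rewrite negb_and /=; apply/orP; right.
by move: jb; rewrite -{1}(prednK j0) /= => <-; case: (odd _).
Qed.

Lemma card_steps : #|steps| = k.-1.
Proof.
rewrite /steps; case: k => [|n].
  by apply/eqP; rewrite cards_eq0; apply/eqP/finset.setP => -[].
rewrite (_ : finset _ = [set~ ord0]%SET); last first.
  by apply/finset.setP => j; rewrite !inE lt0n.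
by rewrite cardsC1 card_ord.
Qed.

Lemma V_E (R : realType) (V : choiceType) (t : R) (S : k.-tuple V) (x : V -> R) :
  V_ t S x = (\sum_(j in steps)
    (`|x (tnth S j) - x (tnth S (prev j))| <= Num.sqrt 2 * t)%R)%N.
Proof.
rewrite /V_ (exchange_big_dep xpredT)//= [RHS]big_mkcond/=.
apply: eq_bigr => j _; rewrite inE; case: ifPn => j0.
  rewrite (big_pred1 (prev j))// => i /=.
  by rewrite -{1}(prednK j0) eqSS eq_sym.
by rewrite big_pred0// => i; case: eqP j0 => // ->.
Qed.

Lemma sum_steps (F : 'I_k -> nat) :
  (\sum_(j in steps) F j =
   \sum_(j in parity_steps true) F j + \sum_(j in parity_steps false) F j)%N.
Proof.
rewrite (bigID (fun j : 'I_k => odd j))/=; congr (_ + _)%N; apply: eq_bigl => j.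
  by rewrite !inE eqb_id.
by rewrite !inE eqbF_neg.
Qed.

End path_indices.

Lemma mem_bool_set (T : Type) (b : T -> bool) w : (w \in [set w | b w]) = b w.
Proof. by apply/idP/idP; rewrite inE. Qed.

Lemma null_tail d (T : measurableType d) (R : realType) (V : choiceType)
    (X : V -> {mfun T >-> R}) (P0 : probability T R) (k : nat) (S : k.-tuple V)
    (t : R) :
  null_model X P0 -> uniq S -> 0 < t -> 2 * p_ t <= 1 ->
  fine (P0 [set w | k%:R / 2 < (V_ t S (fun v => X v w))%:R :> R]) <=
  2 * expR (- (k%:R / 4 * h (2 * p_ t))).
Proof.
move=> null uS t0 p1.
have inj : injective (tnth S) by apply/tuple_uniqP.
have iZ : iid_gauss P0 (fun j => X (tnth S j) : T -> R).
  exact: iid_standard_normal_gauss null inj _.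
have [mZ _] := iZ.
pose D (j : 'I_k) :=
  [set w | `|X (tnth S j) w - X (tnth S (prev j)) w| <= Num.sqrt 2 * t].
have mD j : measurable (D j).
  have mf : measurable_fun [set: T] (fun w => `|X (tnth S j) w - X (tnth S (prev j)) w|).
    by apply: measurableT_comp => //; exact: measurable_funB.
  rewrite (_ : D j = [set: T] `&` (fun w => `|X (tnth S j) w - X (tnth S (prev j)) w|)
    @^-1` `]-oo, Num.sqrt 2 * t]); first exact: mf.
  by apply/seteqP; split => w; rewrite /D /= in_itv/=; tauto.
have VE w : V_ t S (fun v => X v w) = (\sum_(j in steps k) (w \in D j))%N.
  by rewrite V_E; apply: eq_bigr => j _; rewrite mem_bool_set.
pose E b := [set w | (k%:R / 4 : R) < (\sum_(j in parity_steps k b) (w \in D j))%N%:R].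
have PE b : fine (P0 (E b)) <= expR (- (k%:R / 4 * h (2 * p_ t))).
  apply: chernoff_count => //; first exact: p_gt0.
    rewrite -[X in (_ <= X)%N]card_ord; apply: (@card_disjoint_pairs _ (@prev k)).
      exact: prev_inj_parity_steps.
    exact: prev_parity_steps.
  move=> A /fintype.subsetP Ab; apply: (iid_gauss_pairs iZ (ltW t0)).
    by move=> i j /Ab iA /Ab jA; exact: (prev_inj_parity_steps iA jA).
  move=> j /Ab jA; apply: contra (prev_parity_steps jA) => /Ab //.
have mV : measurable [set w | k%:R / 2 < (V_ t S (fun v => X v w))%:R :> R].
  by under eq_set do rewrite VE; exact: measurable_count_gt.
have := @weighted_union_bound _ _ _ P0 bool [:: true; false] (fun=> 1) E 1 _ mV.
rewrite !big_cons !big_nil !mul1r addr0 => H.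
apply: (@le_trans _ _ (fine (P0 (E true)) + fine (P0 (E false)))).
  apply: H => [b|w]; first exact: measurable_count_gt.
  rewrite !big_cons big_nil !mul1r addr0 indicE.
  have [/set_mem/=|_] := boolP (w \in _); last by rewrite addr_ge0.
  rewrite VE sum_steps natrD => Hw.
  have [Ew|Ew] := boolP (w \in E true).
    by rewrite [X in X + _]indicE Ew lerDl.
  rewrite [X in _ + X]indicE mem_set ?lerDr//.
  move: Ew; rewrite mem_bool_set -leNgt /E/= => Ew.
  by move: Ew Hw; lra.
have := PE true; have := PE false; lra.
Qed.

(** * Covariances of the normalised autoregressive increments *)

Section autoregressive_covariance.
Variables (R : realType) (psi : R).
Hypotheses (psi0 : 0 <= psi) (psi1 : psi < 1).

Lemma sum_geometric (n : nat) : \sum_(0 <= j < n) psi ^+ j * (1 - psi) <= 1.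
Proof.
suff -> : \sum_(0 <= j < n) psi ^+ j * (1 - psi) = 1 - psi ^+ n.
  by rewrite gerBl exprn_ge0.
elim: n => [|n IH]; first by rewrite big_nil expr0 subrr.
by rewrite big_nat_recr//= IH exprS; ring.
Qed.

(** The indices on either side of [i] give a geometric sum each. The factor [1 - psi] compensates
    for the slow decay when [psi] is close to 1. *)
Lemma sum_geometric_dist (n i : nat) : (i < n)%N ->
  \sum_(j < n | j != i :> nat) psi ^+ (`|i - j|%N).-1 * (1 - psi) <= 2.
Proof.
move=> ni.
rewrite -(big_mkord (fun j => j != i) (fun j => psi ^+ (`|i - j|%N).-1 * (1 - psi))).
rewrite (big_cat_nat (n := i))//=; last exact: ltnW.
rewrite [X in _ + X]big_ltn_cond// eqxx/=.
have -> : \sum_(0 <= j < i | j != i) psi ^+ (`|i - j|%N).-1 * (1 - psi) =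
    \sum_(0 <= j < i) psi ^+ j * (1 - psi).
  rewrite big_nat_rev/= big_nat_cond [RHS]big_nat_cond.
  apply: eq_big => [j|j /andP[/andP[_ ji] _]].
    by case: (ltnP j i) => ji; rewrite /= ?andbF//; apply/eqP; lia.
  by congr (psi ^+ _ * _); lia.
have -> : \sum_(i.+1 <= j < n | j != i) psi ^+ (`|i - j|%N).-1 * (1 - psi) =
    \sum_(0 <= j < n - i.+1) psi ^+ j * (1 - psi).
  rewrite -{1}[i.+1]add0n big_addn big_nat_cond [RHS]big_nat_cond.
  apply: eq_big => [j|j _].
    by case: (0 <= j < _)%N => //=; apply/eqP; lia.
  by congr (psi ^+ _ * _); lia.
have := sum_geometric i; have := sum_geometric (n - i.+1); lra.
Qed.

(** Off the diagonal the four distances lie on one side of 0, where [psi ^+ m] is a pure geometric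
    sequence; on the diagonal the value would be [2 (1 - psi)]. *)
Lemma second_difference_dist (a b : nat) : a != b ->
  psi ^+ `|a - b|%N - psi ^+ `|a.+1 - b|%N - psi ^+ `|a - b.+1|%N
    + psi ^+ `|a - b|%N = - (psi ^+ (`|a - b|%N).-1 * (1 - psi) ^+ 2).
Proof.
rewrite neq_ltn => /orP[] lt_ab.
- have [m ->] : exists m, b = (a + m.+1)%N by exists (b - a.+1)%N; lia.
  have -> : `|a - (a + m.+1)|%N = m.+1 by lia.
  have -> : `|a.+1 - (a + m.+1)|%N = m by lia.
  have -> : `|a - (a + m.+1).+1|%N = m.+2 by lia.
  by rewrite /= !exprS; ring.
- have [m ->] : exists m, a = (b + m.+1)%N by exists (a - b.+1)%N; lia.
  have -> : `|b + m.+1 - b|%N = m.+1 by lia.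
  have -> : `|(b + m.+1).+1 - b|%N = m.+2 by lia.
  have -> : `|b + m.+1 - b.+1|%N = m by lia.
  by rewrite /= !exprS; ring.
Qed.

(** Coefficients of the [j]-th increment, divided by its standard deviation: [2 * (1 - psi)] is its
    variance under the alternative. *)
Definition increment (k : nat) (j l : 'I_k) : R :=
  (Num.sqrt (2 * (1 - psi)))^-1 * ((l == j)%:R - (l == prev j)%:R).

Lemma sum_increment (k : nat) (j : 'I_k) (f : 'I_k -> R) :
  \sum_l increment j l * f l =
  (Num.sqrt (2 * (1 - psi)))^-1 * (f j - f (prev j)).
Proof.
have E i : \sum_l (l == i)%:R * f l = f i.
  rewrite (bigD1 i)//= eqxx mul1r big1 ?addr0//.
  by move=> l /negbTE ->; rewrite mul0r.
rewrite -(E j) -[in RHS](E (prev j)) -sumrB mulr_sumr.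
by apply: eq_bigr => l _; rewrite -mulrBl mulrA.
Qed.

Let sqr_scale : (Num.sqrt (2 * (1 - psi)))^-1 ^+ 2 = (2 * (1 - psi))^-1.
Proof. by rewrite exprVn sqr_sqrtr// mulr_ge0// subr_ge0 ltW. Qed.

Local Notation K k := (fun i j : 'I_k => psi ^+ `|i - j|%N).

(** Expressing everything from [i.-1] and [j.-1] turns the truncated predecessors into successors,
    the form of [second_difference_dist]. *)
Let quad_increment (k : nat) (i j : 'I_k) : i \in steps k -> j \in steps k ->
  quad (K k) (increment i) (increment j) = (2 * (1 - psi))^-1 *
   (psi ^+ `|i.-1 - j.-1|%N - psi ^+ `|i.-1.+1 - j.-1|%N
    - psi ^+ `|i.-1 - j.-1.+1|%N + psi ^+ `|i.-1 - j.-1|%N).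
Proof.
rewrite !inE => i0 j0.
have E a : \sum_b increment i a * increment j b * K k a b =
    increment i a * ((Num.sqrt (2 * (1 - psi)))^-1 * (K k a j - K k a (prev j))).
  by rewrite -(sum_increment j (K k a)) mulr_sumr; apply: eq_bigr => b _; rewrite mulrA.
rewrite /quad; under eq_bigr do rewrite E.
rewrite sum_increment -mulrBr mulrA -expr2 sqr_scale /=.
have -> : `|i - j|%N = `|i.-1 - j.-1|%N by lia.
by rewrite !prednK//; congr (_ * _); ring.
Qed.

Lemma quad_increment_diag (k : nat) (i : 'I_k) : i \in steps k ->
  quad (K k) (increment i) (increment i) = 1.
Proof.
move=> iS; rewrite quad_increment// distnn.
have -> : `|i.-1.+1 - i.-1|%N = 1%N by lia.
have -> : `|i.-1 - i.-1.+1|%N = 1%N by lia.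
rewrite expr0 expr1 -[RHS](@mulVf _ (2 * (1 - psi))); first by congr (_ * _); ring.
by rewrite mulf_neq0// subr_eq0 gt_eqF.
Qed.

Lemma quad_increment_offdiag (k : nat) (i j : 'I_k) :
  i \in steps k -> j \in steps k -> i != j ->
  quad (K k) (increment i) (increment j) =
  - (psi ^+ (`|i - j|%N).-1 * (1 - psi) / 2).
Proof.
move=> iS jS ij; rewrite quad_increment//.
move: (iS) (jS); rewrite !inE => i0 j0.
rewrite second_difference_dist; last first.
  by apply: contra ij => /eqP ij; apply/eqP/val_inj; rewrite /= -(prednK i0) ij prednK.
have -> : `|i.-1 - j.-1|%N = `|i - j|%N by lia.
by field; rewrite subr_eq0 gt_eqF.
Qed.

End autoregressive_covariance.

Lemma fine_probability_le d (T : measurableType d) (R : realType)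
    (P : probability T R) (A B : set T) :
  measurable A -> measurable B -> A `<=` B -> fine (P A) <= fine (P B).
Proof.
move=> mA mB AB; apply: fine_le; [exact: fin_num_measure|exact: fin_num_measure|].
by apply: le_measure; rewrite ?inE.
Qed.

Lemma measurable_observation d (T : measurableType d) (R : realType)
    (V : choiceType) (X : V -> {mfun T >-> R}) :
  measurable_fun [set: T] (fun w => (fun v => X v w) : product_space R V).
Proof.
pose G := \bigcup_(v in [set: V])
  preimage_set_system [set: V -> R] (fun x => x v) (@measurable _ R).
refine (@measurability _ _ T (product_space R V) setT
  (fun w => (fun v => X v w) : product_space R V) G _ _); first by [].
move=> _ [_ [v _ [B mB <-]] <-].
rewrite (_ : _ `&` _ = [set: T] `&` X v @^-1` B); first exact: measurable_funP.
by apply/seteqP; split => x /=; tauto.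
Qed.

Lemma measurable_V_le d (T : measurableType d) (R : realType) (V : choiceType)
    (X : V -> {mfun T >-> R}) (k : nat) (S : k.-tuple V) (t x : R) :
  measurable [set w | (V_ t S (fun v => X v w))%:R <= x :> R].
Proof.
have m := measurableT_comp (measurable_V_ t S) (measurable_observation X).
rewrite -[X in measurable X]setTI; have := m measurableT _ (measurable_itv `]-oo, x]).
by congr measurable; apply/seteqP; split => w; rewrite /= in_itv.
Qed.

(** * Type II error along the planted path *)

Section alternative.
Context d (T : measurableType d) (R : realType) (P : probability T R).
Context (V : choiceType) (X : V -> {mfun T >-> R}) (k : nat) (S : k.-tuple V).
Variables (psi t : R).
Local Notation q := (@normal_df_inv R (4 / 5)).
Local Notation L := (6 * q * @normal_peak R 1).

Hypothesis model : path_model X S psi P.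
Hypotheses (psi0 : 0 <= psi) (psi1 : psi < 1) (t0 : 0 < t).
Hypothesis psit : 1 - (t / q) ^+ 2 <= psi.

Let Y (j : 'I_k) := X (tnth S j).
Let U (j : 'I_k) := lincomb Y (increment psi j).
(** The threshold is [q], not the one of the test, so that the probability is 3/5 whatever [psi] and
    [t]. *)
Let D (j : 'I_k) := [set w | `|U j w| <= q].

Let gaussY : centered_gaussian_vector P Y.
Proof. by case: model. Qed.

Let covY i j : covariance P (Y i) (Y j) = (psi ^+ `|i - j|%N)%:E.
Proof. by case: model => _ covX _ _; exact: covX. Qed.

Let UE j w : U j w = (Num.sqrt (2 * (1 - psi)))^-1 *
  (X (tnth S j) w - X (tnth S (prev j)) w).
Proof. exact: sum_increment. Qed.

Let mD j : measurable (D j).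
Proof.
have mf : measurable_fun [set: T] (fun w => `|U j w|).
  by apply: measurableT_comp => //; exact: measurable_lincomb.
rewrite (_ : D j = [set: T] `&` (fun w => `|U j w|) @^-1` `]-oo, q]).
  exact: mf.
by apply/seteqP; split => w; rewrite /D /= in_itv/=; tauto.
Qed.

(** The lower bound on [psi] enters here: it says that [sqrt (1 - psi) <= t / q], so [q] standard
    deviations of an increment are at most [sqrt 2 * t]. *)
Let close_step j w : D j w ->
  `|X (tnth S j) w - X (tnth S (prev j)) w| <= Num.sqrt 2 * t.
Proof.
have q0 := normal_df_inv_45_gt0 R.
have v0 : 0 < 1 - psi by rewrite subr_gt0.
have s0 : 0 < Num.sqrt (2 * (1 - psi)) by rewrite sqrtr_gt0 mulr_gt0.
rewrite /D /= UE normrM normfV (ger0_norm (ltW s0)) mulrC ler_pdivrMr// => /le_trans.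
apply; rewrite sqrtrM// mulrCA ler_wpM2l//.
have -> : t = q * (t / q) by field; rewrite gt_eqF.
rewrite ler_wpM2l ?(ltW q0)// -[leRHS]ger0_norm ?divr_ge0 ?(ltW t0) ?(ltW q0)//.
by rewrite -sqrtr_sqr ler_wsqrtr// lerBlDl -lerBlDr.
Qed.

Let prob_D i : i \in steps k -> P (D i) = (3 / 5)%:E.
Proof.
move=> iS; have [al al1 H] := gaussian_vector_law1 gaussY covY (increment psi i).
rewrite (quad_increment_diag psi0 psi1 iS) in al1.
have nal : `|al| = 1.
  have : `|al| ^+ 2 = 1 by rewrite real_normK ?num_real.
  by move/eqP; rewrite sqrp_eq1// => /eqP.
have := H `[- q, q]%classic (measurable_itv _).
rewrite (_ : [set w | _] = D i); last first.
  by apply/seteqP; split => w; rewrite /D /= in_itv/= -ler_norml.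
move=> ->; rewrite (_ : [set x | _] = `[- q, q]%classic); last first.
  by apply/seteqP; split => x; rewrite /= !in_itv/= -!ler_norml normrM nal mul1r.
rewrite -p_inv_45 p_E ?(ltW (normal_df_inv_45_gt0 R))//.
by rewrite fineK// fin_num_measure.
Qed.

(** The diagonal gets the trivial bound on a probability; elsewhere this is [gauss2_square_le] at
    the correlation of the two increments. *)
Let err (i j : 'I_k) : R :=
  if j == i then 1 else L * (psi ^+ (`|i - j|%N).-1 * (1 - psi) / 2).

Let prob_DD i j : i \in steps k -> j \in steps k ->
  fine (P (D i `&` D j)) <= (3 / 5) ^+ 2 + err i j.
Proof.
move=> iS jS; rewrite /err; case: eqVneq => [_|ji].
  have : fine (P (D i `&` D j)) <= 1.
    rewrite -lee_fin fineK; last by rewrite fin_num_measure//; exact: measurableI.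
    by apply: probability_le1; exact: measurableI.
  by have := sqr_ge0 (3 / 5 : R); lra.
have ij : i != j by rewrite eq_sym.
set rho := psi ^+ (`|i - j|%N).-1 * (1 - psi) / 2.
have rho0 : 0 <= rho by rewrite /rho divr_ge0// mulr_ge0 ?exprn_ge0// subr_ge0 ltW.
have rho1 : rho <= 1 / 2.
  rewrite /rho ler_pM2r ?invr_gt0//.
  rewrite -[leRHS]mul1r ler_pM ?exprn_ge0 ?subr_ge0 ?(ltW psi1)//.
    by rewrite exprn_ile1// ltW.
  by rewrite gerBl.
have := quad_increment_offdiag psi0 psi1 iS jS ij; rewrite -/rho => quadE.
have [|al [be [de [al1 albe bede H]]]] :=
  @gaussian_vector_law2 _ _ _ _ _ _ _ gaussY covY (increment psi i) (increment psi j).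
  (* Unit variances and a correlation of at most 1/2 in absolute value make the Cauchy-Schwarz
     inequality strict. *)
  rewrite quadE !quad_increment_diag// sqrrN mulr1.
  by rewrite expr_lt1//; lra.
rewrite quadE in albe; rewrite !quad_increment_diag// in al1 bede.
have nrho : `|- rho| = rho by rewrite normrN ger0_norm.
have [|_] := @gauss2_square_le R q al be de (- rho) (normal_df_inv_45_gt0 R) _
  al1 albe bede.
  by rewrite nrho.
rewrite nrho p_inv_45; apply: le_trans; rewrite le_eqVlt; apply/orP; left; apply/eqP.
have mG : measurable (`[- q, q] `*` `[- q, q] : set (R * R)) by exact: measurableX.
have := H _ mG.
rewrite (_ : [set w | _] = D i `&` D j); last first.
  by apply/seteqP; split => w; rewrite /D /= !in_itv/= -!ler_norml.
move=> ->; congr (fine (_ _)).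
by apply/seteqP; split => z; rewrite /= !in_itv/= -!ler_norml.
Qed.

Let err0 i j : 0 <= err i j.
Proof.
rewrite /err; case: ifP => // _; rewrite mulr_ge0//.
  by rewrite !mulr_ge0// ?normal_peak_ge0// ltW// normal_df_inv_45_gt0.
by rewrite divr_ge0// mulr_ge0 ?exprn_ge0// subr_ge0 ltW.
Qed.

Let sum_err : \sum_(i in steps k) \sum_(j in steps k) err i j <= k%:R * (1 + L).
Proof.
have L0 : 0 <= L.
  by rewrite !mulr_ge0// ?normal_peak_ge0// ltW// normal_df_inv_45_gt0.
have row i : \sum_(j in steps k) err i j <= 1 + L.
  apply: (@le_trans _ _ (\sum_j err i j)).
    by rewrite [leRHS](bigID (mem (steps k)))/= lerDl sumr_ge0.
  rewrite (bigD1 i)//= {1}/err eqxx lerD2l.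
  have -> : \sum_(j < k | j != i) err i j =
      L / 2 * \sum_(j < k | j != i :> nat) psi ^+ (`|i - j|%N).-1 * (1 - psi).
    rewrite mulr_sumr; apply: eq_big => // j ji.
    by rewrite /err (negbTE ji); field.
  have := sum_geometric_dist psi0 psi1 (ltn_ord i).
  by move=> /(ler_wpM2l (divr_ge0 L0 (ler0n R 2))); lra.
apply: (@le_trans _ _ (\sum_(i in steps k) (1 + L))); first exact: ler_sum.
rewrite sumr_const card_steps -[leLHS]mulr_natl ler_wpM2r ?addr_ge0//.
by rewrite ler_nat leq_pred.
Qed.

(** The mean [(k - 1) 3/5] exceeds [k / 2] by [k / 10 - 3/5], which is at least [k / 20] exactly
    when [k >= 12]; the constant 400 is [20^2]. *)
Lemma alternative_tail : (12 <= k)%N ->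
  fine (P [set w | (V_ t S (fun v => X v w))%:R <= k%:R / 2 :> R]) <=
  400 * (1 + L) / k%:R.
Proof.
move=> k12; have kR : 12 <= k%:R :> R by rewrite (ler_nat R 12).
have kp : k.-1%:R = k%:R - 1 :> R.
  by rewrite -[in RHS](prednK (leq_trans (isT : 0 < 12)%N k12)) -natr1 addrK.
have mnum : #|steps k|%:R * (3 / 5) - k%:R / 2 = k%:R / 10 - 3 / 5 :> R.
  by rewrite card_steps kp; field.
have L0 : 0 <= L.
  by rewrite !mulr_ge0// ?normal_peak_ge0// ltW// normal_df_inv_45_gt0.
have ap : k%:R / 2 < #|steps k|%:R * (3 / 5) :> R by rewrite -subr_gt0 mnum; lra.
have := chebyshev_count mD ap prob_D prob_DD; rewrite mnum => H.
apply: le_trans (le_trans H _).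
  apply: fine_probability_le; [exact: measurable_V_le|exact: measurable_count_le|].
  move=> w /=; apply: le_trans; rewrite ler_nat V_E; apply: leq_sum => j _.
  by rewrite mem_bool_set; case: (leP `|U j w|) => // Dj; rewrite close_step.
have d0 : 0 < k%:R / 20 :> R by lra.
apply: (@le_trans _ _ (k%:R * (1 + L) / (k%:R / 20) ^+ 2)).
  apply: ler_pM => //.
  - by apply: sumr_ge0 => i _; apply: sumr_ge0 => j _; exact: err0.
  - by rewrite invr_ge0 sqr_ge0.
  - have d1 : k%:R / 20 <= k%:R / 10 - 3 / 5 :> R by lra.
    have d2 := lt_le_trans d0 d1.
    by rewrite lef_pV2 ?posrE ?exprn_gt0// lerXn2r// nnegrE ltW.
by rewrite le_eqVlt; apply/orP; left; apply/eqP; field; rewrite gt_eqF//; lra.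
Qed.

End alternative.

(** * From the two error bounds to the risk *)

Lemma h_ge1 (R : realType) (x : R) : 0 < x -> x < 2 -> 1 <= h x -> x < 1.
Proof.
move=> x0 x2; rewrite /h => hx; rewrite ltNge; apply/negP => x1.
(* For [1 <= x < 2] the logarithm is nonnegative, so [h x <= x - 1 < 1]. *)
by have := ln_ge0 x1; lra.
Qed.

Theorem proposition1 (R : realType) :
  exists2 r : nat -> R, r k @[k --> \oo] --> (0 : R) &
  forall (k : nat) (V : choiceType) (E : set (V * V)) (C : {fset k.-tuple V})
         (d : measure_display) (T : measurableType d)
         (X : V -> {mfun T >-> R}) (P0 : probability T R)
         (P : k.-tuple V -> probability T R) (t psi : R),
    (0 < k)%N ->
    C != fset0 ->
    (forall S, S \in C -> open_path E S) ->
    is_largest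
      [set s : R | 0 < s /\
         Num.max (8 / k%:R * ln (#|` C|%fset)%:R) 1 <= h (2 * p_ s)] t ->
    -1 < psi < 1 ->
    1 - (t / normal_df_inv (4 / 5)) ^+ 2 <= psi ->
    null_model X P0 ->
    (forall S, S \in C -> path_model X S psi (P S)) ->
    (worst_case_risk X P0 P C (path_test C t) <= (r k)%:E)%E.
Proof.
pose q : R := normal_df_inv (4 / 5).
pose L := 6 * q * normal_peak 1.
have q0 : 0 < q := normal_df_inv_45_gt0 R.
have L0 : 0 <= L by rewrite !mulr_ge0// ?normal_peak_ge0// ltW.
(* The term in 16 bounds the type I error, the other one the type II error. *)
exists (fun k => (16 + 400 * (1 + L)) * k%:R^-1).
  rewrite -[X in _ --> X](mulr0 (16 + 400 * (1 + L))).
  apply: cvgM; first exact: cvg_cst.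
  rewrite gtr0_cvgV0; first exact: cvgr_idn.
  by near=> k; rewrite ltr0n; near: k; exists 1%N.
move=> k V E C d T X P0 P t psi k0 C0 pathC [[t0 ht] _] /andP[_ psi1] psit null alt.
have kR : 0 < k%:R :> R by rewrite ltr0n.
have [h1 hC] : 1 <= h (2 * p_ t) /\ 8 / k%:R * ln (#|` C|%fset)%:R <= h (2 * p_ t).
  by move: ht; rewrite ge_max => /andP[].
have p0 := p_gt0 t0.
have p1 : 2 * p_ t < 1.
  by apply: h_ge1 => //; [rewrite mulr_gt0|have := p_lt1 t; lra].
have tq : t < q.
  rewrite ltNge; apply/negP; rewrite le_eqVlt => /orP[/eqP qt|/normal_df_lt].
    by move: p1; rewrite -qt p_inv_45; lra.
  by rewrite normal_df_inv_45; move: p1; rewrite /p_; lra.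
have psi0 : 0 <= psi.
  apply: le_trans psit; rewrite subr_ge0 -[leRHS](expr1n _ 2) lerXn2r ?nnegrE//.
    by rewrite divr_ge0 ?ltW.
  by rewrite ler_pdivrMr// mul1r ltW.
have card0 : (0 < #|` C|)%N by rewrite cardfs_gt0.
have mrej b : measurable [set w | path_test C t (fun v => X v w) = b].
  have := measurableT_comp (measurable_path_test_fun C t) (measurable_observation X).
  move=> /(_ measurableT [set b]) /=; rewrite setTI; exact.
have null_le : fine (P0 [set w | path_test C t (fun v => X v w) = true]) <=
    16 / k%:R.
  (* The exponential is weakened to [16 / k] by [expR x >= x] at [x = k / 8], to share the rate of
     the type II error. *)
  apply: (@le_trans _ _ (2 * expR (- (k%:R / 8)))); last first.
    have k80 : 0 < k%:R / 8 :> R by rewrite divr_gt0.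
    have -> : 16 / k%:R = 2 * (k%:R / 8)^-1 :> R by field; rewrite gt_eqF.
    rewrite expRN ler_pM2l// lef_pV2 ?posrE ?expR_gt0//.
    by apply: le_trans (expR_ge1Dx _); lra.
  have := @weighted_union_bound _ _ _ P0 _ (enum_fset C) (fun=> 1)
    (fun S => [set w | k%:R / 2 < (V_ t S (fun v => X v w))%:R :> R]) 1 _ (mrej true).
  rewrite mul1r => H; apply: (le_trans (H _ _)) => {H}.
  - move=> S; rewrite (_ : mkset _ =
      ~` [set w | (V_ t S (fun v => X v w))%:R <= k%:R / 2 :> R]).
      by apply: measurableC; exact: measurable_V_le.
    by apply/seteqP; split => w /=; rewrite ltNge => /negP.
  - move=> w; rewrite mul1r indicE; have [/set_mem/=|_] := boolP (w \in _); last first.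
      by apply: sumr_ge0 => S _; rewrite mul1r.
    rewrite /path_test_fun /V_max => Vw.
    have [S SC ES] : exists2 S, S \in C &
        (\max_(S' <- C) V_ t S' (fun v => X v w) = V_ t S (fun v => X v w))%N.
      (* The maximum starts from 0, so it is attained in [C] unless it is 0, which a value above
         [k / 2] excludes. *)
      have : (\max_(S' <- C) V_ t S' (fun v => X v w) = 0)%N \/
          exists2 S, S \in C &
            (\max_(S' <- C) V_ t S' (fun v => X v w) = V_ t S (fun v => X v w))%N.
        rewrite big_seq.
        apply: (big_ind (fun m => m = 0%N \/
          exists2 S, S \in C & m = V_ t S (fun v => X v w))) => [|x y Hx Hy|S SC].
        - by left.
        - by rewrite /maxn; case: ifP.
        - by right; exists S.
      case=> // V0; move: Vw; rewrite V0 ltNge => /negP[].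
      by rewrite divr_ge0// ltW.
    rewrite ES in Vw.
    rewrite (big_rem S)//= mul1r [X in X + _]indicE mem_set//.
    by rewrite lerDl; apply: sumr_ge0 => S' _; rewrite mul1r.
  apply: (@le_trans _ _ (\sum_(S <- C) 2 * expR (- (k%:R / 4 * h (2 * p_ t))))).
    rewrite big_seq [leRHS]big_seq; apply: ler_sum => S SC; rewrite mul1r.
    by apply: null_tail => //; [case: (pathC S SC)|exact: ltW].
  rewrite big_const_seq count_predT iter_addr addr0 -[leLHS]mulr_natl mulrCA.
  (* Half of the exponent [(k/4) h (2 p_t)] absorbs the logarithm of the cardinality; the other half
     is at least [k / 8]. *)
  rewrite ler_pM2l// -[X in X * _](@lnK R) ?posrE ?ltr0n// -expRD ler_expR.
  have : ln (#|` C|%fset)%:R <= k%:R / 8 * h (2 * p_ t).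
    have -> : ln (#|` C|%fset)%:R = k%:R / 8 * (8 / k%:R * ln (#|` C|%fset)%:R) :> R.
      by field; rewrite gt_eqF.
    by rewrite ler_pM2l// divr_gt0.
  have : k%:R / 8 * 1 <= k%:R / 8 * h (2 * p_ t) by rewrite ler_pM2l// divr_gt0.
  lra.
have alt_le S : S \in C ->
    (P S [set w | path_test C t (fun v => X v w) = false] <=
     (400 * (1 + L) / k%:R)%:E)%E.
  move=> SC; rewrite -[leLHS]fineK ?fin_num_measure// lee_fin.
  (* For short paths the claimed bound exceeds 1. *)
  have [k12|k12] := ltnP k 12.
    apply: (@le_trans _ _ 1).
      by rewrite -lee_fin fineK ?fin_num_measure// probability_le1.
    rewrite ler_pdivlMr// mul1r.
    have : k%:R <= 12 :> R by rewrite (ler_nat R _ 12) ltnW.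
    lra.
  apply: le_trans (alternative_tail (alt S SC) psi0 psi1 t0 psit k12).
  apply: fine_probability_le => //; first exact: measurable_V_le.
  move=> w /= /negbT; rewrite /path_test_fun -leNgt; apply: le_trans.
  by rewrite ler_nat; exact: (leq_bigmax_seq _ SC).
rewrite /worst_case_risk mulrDl EFinD; apply: leeD.
  by rewrite -[leLHS]fineK ?fin_num_measure// lee_fin.
rewrite big_seq.
apply: (big_ind (fun x => (x <= (400 * (1 + L) / k%:R)%:E)%E)) => [|x y xr yr|] //.
  by rewrite leNye.
by rewrite ge_max xr yr.
Unshelve. all: by end_near. Qed.
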